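(* Let $\alpha\in(0,1)$, let $J=[0,T]$ for some $T>0$ or $J=[0,\infty)$, and let $f:J\times\mathbb{R}\to\mathbb{R}$ be continuous and satisfy $|f(t,x)-f(t,y)|\le L(t)|x-y|$ for all $t\in J$, $x,y\in\mathbb{R}$, where $L:J\to[0,\infty)$ is continuous. Then for any two solutions $x_1(\cdot),x_2(\cdot)$ of ${}^{C}D^\alpha_{0+}x(t)=f(t,x(t))$ on $J$ and any $t\in J$, $$|x_2(t)-x_1(t)|\ \ge\ |x_2(0)-x_1(0)|\,E_\alpha\Big(-\big(\max_{0\le\tau\le t}L(\tau)\big)t^\alpha\Big).$$
   Context: ${}^{C}D^\alpha_{0+}$ is the Caputo fractional derivative of order $\alpha$; a solution is a continuous $x:J\to\mathbb{R}$ with $x(t)=x(0)+\frac{1}{\Gamma(\alpha)}\int_0^t(t-\tau)^{\alpha-1}f(\tau,x(\tau))\,d\tau$ for all $t\in J$. $E_\alpha(z)=\sum_{k=0}^\infty\frac{z^k}{\Gamma(\alpha k+1)}$ is the Mittag-Leffler function. *)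

(* Defs.v *)
From HB Require Import structures.
From mathcomp Require Import all_boot all_order all_algebra.
From mathcomp Require Import all_classical all_reals all_analysis.
Set Implicit Arguments. Unset Strict Implicit. Unset Printing Implicit Defensive.
Import Order.TTheory GRing.Theory Num.Theory.
Import numFieldNormedType.Exports.
Local Open Scope classical_set_scope.
Local Open Scope ring_scope.

Definition Gamma {R : realType} (s : R) : R :=
  Rintegral (@lebesgue_measure R) `]0, +oo[ (fun x => x `^ (s - 1) * expR (- x)).

Definition mittag_leffler {R : realType} (a z : R) : R :=
  limn (fun n => \sum_(0 <= k < n) (z ^+ k / Gamma (a * k%:R + 1))).

(* x is a solution on J of the Caputo equation  ^C D^a_{0+} x(t) = f(t, x(t)):
   x continuous on J and the integral (Volterra) form holds for all t in J. *)
Definition caputo_solution {R : realType} (a : R) (J : set R)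
    (f : R -> R -> R) (x : R -> R) : Prop :=
  {within J, continuous x} /\
  forall t, J t ->
    x t = x 0 + (Gamma a)^-1 *
      Rintegral (@lebesgue_measure R) `[0, t]
        (fun tau => (t - tau) `^ (a - 1) * f tau (x tau)).

(* Main.v *)
Require Import Defs.
From HB Require Import structures.
From mathcomp Require Import all_boot all_order all_algebra.
From mathcomp Require Import all_classical all_reals all_analysis.
From mathcomp Require Import measurable_realfun ring lra.
Import Order.TTheory GRing.Theory Num.Theory.
Import numFieldNormedType.Exports.
Local Open Scope classical_set_scope.
Local Open Scope ring_scope.

(** The difference z of two solutions with z(0) > 0 satisfies
    z = z(0) + I^a g with g >= - M z as long as z >= 0, while
    u(t) = z(0) E_a(- M t^a) satisfies u = z(0) - M I^a u.  So z >= u follows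
    from a minimum principle for the Abel integral: if y = y0 + I^a phi with
    y0 >= 0 and phi >= 0 wherever y < 0, then y >= 0.

    To prove it, let t1 be a point where y attains a negative minimum and pick
    t0 < t1 with y < 0 on [t0, t1].  The balayage formula
      int_0^t0 (t1 - s)^(a-1) phi(s) ds = int_0^t0 P(r) (I phi)(r) dr,
      P(r) = c (t1 - t0)^a (t0 - r)^(-a) (t1 - r)^(-1),  I = Gamma(a) I^a,
    has P >= 0 and int P < 1; since I^a phi >= y(t1) - y0 on [0, t0] and
    phi >= 0 on [t0, t1], it gives y(t1) - y0 > y(t1) - y0.

    The same principle shows that x |-> E_a(- x) is nonnegative and
    nonincreasing on x >= 0.  If z vanishes for the first time at t1 <= T, then
    E_a(- M t1^a) <= 0, hence E_a(- M T^a) <= 0 and the bound at T is trivial. *)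

(** * Substitution in improper integrals *)

Section substitution.
Context {R : realType}.
Notation mu := (@lebesgue_measure R).

(** One notion covers both []a, b[] and []0, +oo[]: a formula known on each compact interval
    [[u n, v n]] passes to [A] in the limit. *)
Definition exhaustion (A : set R) (u v : nat -> R) :=
  [/\ nonincreasing_seq u, nondecreasing_seq v, forall n, u n <= v n &
      A = \bigcup_n [set` `[u n, v n]]].

Lemma exhaustion_nondecreasing (u v : nat -> R) :
  nonincreasing_seq u -> nondecreasing_seq v ->
  nondecreasing_seq (fun n => [set` `[u n, v n]]).
Proof.
move=> du iv m n mn; rewrite subsetEset; apply: subset_itv; rewrite bnd_simp.
  exact: du.
exact: iv.
Qed.

(** The substitution rule on compact intervals applies to each [[u n, v n]] and its image under [F].
    The integrands being nonnegative, both sides converge by monotone convergence along the two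
    increasing unions. *)
Lemma ge0_integration_by_substitution_exhaustion (F dF G : R -> R)
    (A B : set R) (u v : nat -> R) :
  open A -> exhaustion A u v -> is_interval B ->
  {in A &, {homo F : x y / x < y}} ->
  (forall x, A x -> is_derive x (1 : R) F (dF x)) ->
  (forall x, A x -> {for x, continuous dF}) ->
  (forall x, A x -> 0 <= dF x) ->
  (forall x, A x -> B (F x)) ->
  (forall y, B y -> exists2 x, A x & F x = y) ->
  (forall y, B y -> {for y, continuous G}) ->
  (forall y, B y -> 0 <= G y) ->
  (\int[mu]_(y in B) (G y)%:E = \int[mu]_(x in A) (G (F x) * dF x)%:E)%E.
Proof.
move=> oA [du iv uv AE] iB incF dFE cdF dF0 FAB FBA cG G0.
have ndA := exhaustion_nondecreasing _ _ du iv.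
have sA n x : x \in `[u n, v n] -> A x by move=> xn; rewrite AE; exists n.
have uA n : A (u n) by apply: (sA n); rewrite in_itv/= lexx uv.
have vA n : A (v n) by apply: (sA n); rewrite in_itv/= lexx uv.
have leF x y : A x -> A y -> x <= y -> F x <= F y.
  move=> Ax Ay; rewrite le_eqVlt => /predU1P[->//|xy].
  by apply/ltW/incF => //; rewrite inE.
have ndB : nondecreasing_seq (fun n => [set` `[F (u n), F (v n)]]).
  by apply: exhaustion_nondecreasing => m n mn; apply: leF => //;
    [exact: du|exact: iv].
have sB n y : y \in `[F (u n), F (v n)] -> B y.
  rewrite in_itv/= => yn; apply: (iB (F (u n)) (F (v n))) => //; exact: FAB.
(* Monotonicity and surjectivity of [F] carry the exhaustion of [A] to one of [B]. *)
have BE : B = \bigcup_n [set` `[F (u n), F (v n)]].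
  apply/seteqP; split => [y By|y [n _]]; last exact: sB.
  have [x + xy] := FBA _ By; rewrite AE => -[n _ /= xn]; exists n => //=.
  move: (xn); rewrite in_itv/= => /andP[ux xv].
  rewrite -xy in_itv/=; apply/andP; split; apply: leF => //; exact: (sA n).
have cF x : A x -> {for x, continuous F}.
  by move=> /dFE [dx _]; apply: differentiable_continuous; exact/derivable1_diffP.
have dE x : A x -> (derive1 F) x = dF x.
  by move=> Ax; rewrite derive1E; apply: (@derive_val _ _ _ _ _ _ _ (dFE x Ax)).
(* Since [A] is open, [derive1 F] agrees with [dF] in a neighbourhood of [x]. *)
have cF' x : A x -> {for x, continuous (derive1 F)}.
  move=> Ax; rewrite /prop_for /continuous_at dE//.
  apply: cvg_trans (cdF _ Ax); apply: near_eq_cvg.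
  have := open_nbhs_nbhs (conj oA Ax).
  by apply: filterS => y Ay; rewrite dE.
have key n : (\int[mu]_(y in `[F (u n), F (v n)]) (G y)%:E =
   \int[mu]_(x in `[u n, v n]) (G (F x) * dF x)%:E)%E.
  rewrite integration_by_substitution_increasing//.
  - by apply: eq_integral => x /[!inE]/= xn; rewrite -(dE x)//; exact: (sA n).
  - by move=> x y /sA Ax /sA Ay; apply: incF; rewrite inE.
  - move=> x xn; apply: cF'; apply: (sA n); exact: subset_itv_oo_cc xn.
  - apply/cvg_ex; exists ((derive1 F) (u n)); apply: cvg_at_right_filter; exact: cF'.
  - apply/cvg_ex; exists ((derive1 F) (v n)); apply: cvg_at_left_filter; exact: cF'.
  - split.
    + move=> x xn; have Ax : A x by apply: (sA n); exact: subset_itv_oo_cc xn.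
      by have [] := dFE _ Ax.
    + apply: cvg_at_right_filter; exact: cF.
    + apply: cvg_at_left_filter; exact: cF.
  - apply: continuous_in_subspaceT => y /[!inE] /= /sB By; exact: cG.
have mGB n : measurable_fun `[F (u n), F (v n)] (EFin \o G).
  apply/measurable_EFinP; apply: subspace_continuous_measurable_fun => //.
  apply: continuous_in_subspaceT => y /[!inE] /= /sB By; exact: cG.
have mGA n : measurable_fun `[u n, v n] (EFin \o (fun x => G (F x) * dF x)).
  apply/measurable_EFinP; apply: subspace_continuous_measurable_fun => //.
  apply: continuous_in_subspaceT => x /[!inE] /= /sA Ax.
  apply: continuousM; last exact: cdF.
  apply: (@continuous_comp _ _ _ F G); [exact: cF|by apply: cG; exact: FAB].
have cB : (\int[mu]_(y in `[F (u n), F (v n)]) (G y)%:E @[n --> \oo] -->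
          \int[mu]_(y in B) (G y)%:E)%E.
  rewrite [in X in _ --> X]BE; apply: ge0_nondecreasing_set_cvg_integral => //.
  by move=> n y /sB/G0; rewrite lee_fin.
have cA : (\int[mu]_(x in `[u n, v n]) (G (F x) * dF x)%:E @[n --> \oo] -->
          \int[mu]_(x in A) (G (F x) * dF x)%:E)%E.
  rewrite [in X in _ --> X]AE; apply: ge0_nondecreasing_set_cvg_integral => //.
  by move=> n y /sA Ay; rewrite lee_fin mulr_ge0 ?dF0// G0//; exact: FAB.
by move: cB; under eq_fun do rewrite key; move/cvg_lim => <- //; apply/cvg_lim.
Qed.

(** Starting the denominators at 2 keeps the offset at most half of the length, so that the
    endpoints never cross; for [n = 0] both are the midpoint. *)
Lemma exhaustion_oo (a b : R) : a < b ->
  exhaustion `]a, b[ (fun n => a + (b - a) / n.+2%:R)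
                     (fun n => b - (b - a) / n.+2%:R).
Proof.
move=> ab; have ba : 0 < b - a by rewrite subr_gt0.
have nd m n : (m <= n)%N -> (b - a) / n.+2%:R <= (b - a) / m.+2%:R.
  by move=> mn; rewrite ler_pM2l// lef_pV2 ?posrE// ler_nat !ltnS.
split.
- by move=> m n mn; rewrite lerD2l; exact: nd.
- by move=> m n mn; rewrite lerD2l lerN2; exact: nd.
- move=> n; have := nd _ _ (leq0n n : (0 <= n)%N).
  set e := _ / n.+2%:R; rewrite -/(2%:R : R) => ?; lra.
- apply/seteqP; split => [x|x [n _]] /=; rewrite !in_itv/=.
  + move=> /andP[ax xb].
    pose e := Num.min (x - a) (b - x).
    have e0 : 0 < e by rewrite lt_min !subr_gt0 ax xb.
    have [n] : exists n, (b - a) / e <= n.+2%:R.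
      exists (Num.truncn ((b - a) / e)); apply/ltW.
      apply: (lt_le_trans (truncnS_gt _)); by rewrite ler_nat.
    rewrite ler_pdivrMr// mulrC -ler_pdivrMr// => ne.
    exists n => //=; rewrite in_itv/=.
    have : e <= x - a by rewrite ge_min lexx.
    have : e <= b - x by rewrite ge_min lexx orbT.
    by move: ne; set d := _ / n.+2%:R => ? ? ?; apply/andP; split; lra.
  + have : 0 < (b - a) / n.+2%:R by rewrite divr_gt0.
    by set d := _ / n.+2%:R => ? /andP[? ?]; apply/andP; split; lra.
Qed.

Lemma exhaustion_oy :
  exhaustion (`]0, +oo[ : set R) (fun n => n.+1%:R^-1) (fun n => n.+1%:R).
Proof.
split.
- by move=> m n mn; rewrite lef_pV2 ?posrE// ler_nat.
- by move=> m n mn; rewrite ler_nat.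
- by move=> n; apply: (@le_trans _ _ 1); rewrite ?invf_le1 ?ler1n.
- apply/seteqP; split => [x|x [n _]] /=; rewrite !in_itv/= ?andbT.
  + move=> x0; pose N := maxn (Num.truncn x) (Num.truncn x^-1).
    exists N => //=; rewrite in_itv/=; apply/andP; split.
    * rewrite -[leRHS]invrK lef_pV2 ?posrE// ?invr_gt0//.
      by apply/ltW/(lt_le_trans (truncnS_gt _)); rewrite ler_nat ltnS leq_maxr.
    * by apply/ltW/(lt_le_trans (truncnS_gt _)); rewrite ler_nat ltnS leq_maxl.
  + by move=> /andP[+ _]; apply: lt_le_trans; rewrite invr_gt0.
Qed.

End substitution.

(** * The Gamma function *)

Section gamma.
Context {R : realType}.
Notation mu := (@lebesgue_measure R).
Implicit Types p q s t x c : R.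

Lemma powR_continuous p x : 0 < x -> {for x, continuous (@powR R ^~ p)}.
Proof.
move=> x0; apply: differentiable_continuous; apply/derivable1_diffP.
by apply: derivable_powR; rewrite in_itv/= x0.
Qed.

Lemma measurable_fun_powR_comp d (T : measurableType d) (f : T -> R) p :
  measurable_fun setT f -> measurable_fun setT (fun z => f z `^ p).
Proof.
by move=> mf; apply: (measurableT_comp (f := @powR R ^~ p)) mf; exact: measurable_powR.
Qed.

Lemma integral_cst1_oo t : 0 < t ->
  (\int[mu]_(x in `]0%R, t[) (cst 1 x)%:E = t%:E)%E.
Proof.
move=> t0; rewrite (integral_cst mu _ 1%:E)//= mul1e lebesgue_measure_itv/=.
by rewrite lte_fin t0 oppr0 adde0.
Qed.

(** The substitution y = x^p turns p x^(p-1) dx into the length of ]0, t^p[. *)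
Lemma integral_powRB1 p t : 0 < p -> 0 < t ->
  (\int[mu]_(x in `]0%R, t[) (x `^ (p - 1))%:E = (t `^ p / p)%:E)%E.
Proof.
move=> p0 t0.
have tp : 0 < t `^ p by exact: powR_gt0.
have : (\int[mu]_(x in `]0%R, (t `^ p)%R[) (cst 1 x)%:E =
    \int[mu]_(x in `]0%R, t[) (cst 1 (x `^ p) * (p * x `^ (p - 1)))%:E)%E.
  apply: (@ge0_integration_by_substitution_exhaustion R (fun x => x `^ p)
    (fun x => p * x `^ (p - 1)) (cst 1) `]0, t[ `]0, t `^ p[ _ _); last by [].
  - exact: itv_open.
  - exact: exhaustion_oo.
  - exact: interval_is_interval.
  - move=> x y /[!inE]/= /[!in_itv]/= /andP[x0 _] /andP[y0 _] xy.
    by apply: gt0_ltr_powR; rewrite ?nnegrE ?ltW.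
  - by move=> x /= /[!in_itv]/= /andP[x0 _]; exact: is_derive1_powR.
  - move=> x /= /[!in_itv]/= /andP[x0 _]; apply: continuousM.
      exact: cst_continuous.
    exact: powR_continuous.
  - by move=> x _; rewrite mulr_ge0 ?powR_ge0// ltW.
  - move=> x /= /[!in_itv]/= /andP[x0 xt]; rewrite powR_gt0//=.
    by apply: gt0_ltr_powR; rewrite ?nnegrE ?ltW.
  - move=> y /= /[!in_itv]/= /andP[y0 yt]; exists (y `^ p^-1).
      rewrite /= in_itv/= powR_gt0//=.
      rewrite -[ltRHS](@powRr1 _ t) ?ltW// -(@divff _ p) ?gt_eqF// powRrM.
      by apply: gt0_ltr_powR; rewrite ?nnegrE ?invr_gt0 ?ltW.
    by rewrite -powRrM mulVf ?gt_eqF// powRr1// ltW.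
  - by move=> y _; exact: cst_continuous.
under [in X in _ = X -> _]eq_integral do rewrite /= mul1r EFinM.
rewrite integral_cst1_oo// ge0_integralZl_EFin//=; last 3 first.
- by move=> x _; rewrite lee_fin powR_ge0.
- apply: measurable_funTS; apply/measurable_EFinP.
  by apply: measurable_fun_powR_comp.
- exact: ltW.
move=> tpE.
by rewrite mulrC EFinM tpE muleA -EFinM mulVf ?gt_eqF// mul1e.
Qed.

(** The substitution y = 1 - exp(- c x) maps the half-line onto ]0, 1[. *)
Lemma integral_expRN c : 0 < c ->
  (\int[mu]_(x in `]0%R, +oo[) (expR (- (c * x)))%:E = c^-1%:E)%E.
Proof.
move=> c0.
have : (\int[mu]_(x in `]0%R, 1%R[) (cst 1 x)%:E =
    \int[mu]_(x in `]0%R, +oo[)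
     (cst 1 (1 - expR (- (c * x))) * (c * expR (- (c * x))))%:E)%E.
  apply: (@ge0_integration_by_substitution_exhaustion R
    (fun x => 1 - expR (- (c * x))) (fun x => c * expR (- (c * x))) (cst 1)
    `]0, +oo[ `]0, 1[ _ _); last by [].
  - exact: rray_open.
  - exact: exhaustion_oy.
  - exact: interval_is_interval.
  - by move=> x y _ _ xy; rewrite ltrD2l ltrN2 ltr_expR ltrN2 ltr_pM2l.
  - move=> x _; have d1 : is_derive x (1 : R) (fun z => - (c * z)) (- c).
      rewrite (_ : (fun _ => _) = (fun z => - c *: z)); last first.
        by apply/funext => z; rewrite /GRing.scale/= mulNr.
      by apply: is_derive_eq; rewrite /GRing.scale/= mulr1.
    have d2 := is_derive1_comp (is_derive_expR _) d1.
    have d3 := is_deriveB (is_derive_cst (1 : R) x (1 : R)) d2.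
    by apply: (@is_derive_eq _ _ _ _ _ _ _ _ d3); ring.
  - move=> x _; apply: continuousM; first exact: cst_continuous.
    apply: (@continuous_comp _ _ _ (fun x => - (c * x)) expR); last exact: continuous_expR.
    apply: continuousN; apply: continuousM => //; exact: cst_continuous.
  - by move=> x _; rewrite mulr_ge0 ?expR_ge0// ltW.
  - move=> x /= /[!in_itv]/= /andP[x0 _].
    by rewrite subr_gt0 expR_lt1 oppr_lt0 mulr_gt0//= gtrBl expR_gt0.
  - move=> y /= /[!in_itv]/= /andP[y0 y1]; exists (- (ln (1 - y) / c)).
      rewrite /= in_itv/= andbT oppr_gt0 pmulr_llt0 ?invr_gt0//.
      by rewrite ln_lt0// subr_gt0 y1 gtrBl.
    by rewrite mulrN opprK mulrC divfK ?gt_eqF// lnK ?posrE ?subr_gt0//; ring.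
  - by move=> y _; exact: cst_continuous.
under [in X in _ = X -> _]eq_integral do rewrite /= mul1r EFinM.
rewrite integral_cst1_oo// ge0_integralZl_EFin//=; last 2 first.
- apply: measurable_funTS; apply/measurable_EFinP.
  by apply: measurableT_comp => //; exact: measurableT_comp.
- exact: ltW.
move=> tpE.
have cK : 1%E = (c^-1 * c)%:E by rewrite mulVf ?gt_eqF.
by rewrite -[LHS]mul1e [in LHS]cK EFinM -muleA -tpE mule1.
Qed.


(** With y = x / (2 s), the inequality ln y < y gives s ln x <= s ln(2 s) + x / 2, so the constant
    is (2 s)^s. This leaves half of the exponential decay of the Gamma integrand at infinity. *)
Lemma powR_le_expR s : 0 < s ->
  exists2 C, 0 < C & forall x, 1 <= x -> x `^ (s - 1) <= C * expR (x / 2).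
Proof.
move=> s0; exists (expR (s * ln (2 * s))); first exact: expR_gt0.
move=> x x1; have x0 : 0 < x by apply: lt_le_trans x1.
apply: (@le_trans _ _ (x `^ s)); first by apply: ler_powR => //; lra.
rewrite /powR gt_eqF// -expRD ler_expR.
have s2 : 0 < 2 * s by rewrite mulr_gt0.
have -> : x = (2 * s) * (x / (2 * s)) by field; rewrite gt_eqF.
set y := x / (2 * s).
have y0 : 0 < y by rewrite divr_gt0.
rewrite lnM ?posrE// mulrDr lerD2l.
have := @ln_sublinear _ y y0.
rewrite -(ltr_pM2l s0) => /ltW/le_trans; apply.
by rewrite (_ : 2 * s * y / 2 = s * y)//; field.
Qed.

Let gammaf s x := x `^ (s - 1) * expR (- x).

Let gammaf_ge0 s x : 0 <= gammaf s x.
Proof. by rewrite mulr_ge0 ?powR_ge0 ?expR_ge0. Qed.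

Lemma measurable_gammaf s : measurable_fun setT (fun x => x `^ (s - 1) * expR (- x)).
Proof.
apply: measurable_funM; first exact: measurable_fun_powR_comp.
by apply: measurableT_comp => //; exact: measurableT_comp.
Qed.

(** The integral is split at 1. Below 1 the exponential is bounded by one and the power is
    integrable since s > 0; above 1, [powR_le_expR] bounds the integrand by C exp(- x / 2). *)
Lemma Gamma_lty s : 0 < s ->
  (\int[mu]_(x in `]0%R, +oo[) (x `^ (s - 1) * expR (- x))%:E < +oo)%E.
Proof.
move=> s0; have [C C0 leC] := powR_le_expR _ s0.
have -> : `]0%R, +oo[%classic = `]0, 1[%classic `|` `[1, +oo[%classic :> set R.
  by rewrite -itv_bndbnd_setU// bnd_simp.
have mg (D : set R) : measurable D ->
    measurable_fun D (EFin \o (fun x => x `^ (s - 1) * expR (- x))).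
  by move=> mD; apply: measurable_funTS; apply/measurable_EFinP; exact: measurable_gammaf.
rewrite ge0_integral_setU//=; last 3 first.
- by apply: mg; exact: measurableU.
- by move=> x _; rewrite lee_fin gammaf_ge0.
- apply/disj_setPS => x [/=]; rewrite !in_itv/= andbT => /andP[_] x1.
  by rewrite leNgt x1.
apply: lte_add_pinfty.
- apply: (@le_lt_trans _ _ (\int[mu]_(x in `]0%R, 1%R[) (x `^ (s - 1))%:E)%E).
    apply: ge0_le_integral => //=.
    + by move=> x _; rewrite lee_fin gammaf_ge0.
    + exact: mg.
    + by apply: measurable_funTS; apply/measurable_EFinP; exact: measurable_fun_powR_comp.
    + move=> x; rewrite in_itv/= => /andP[x0 _].
      by rewrite lee_fin ler_piMr ?powR_ge0// expR_le1 oppr_le0 ltW.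
  by rewrite integral_powRB1// ltry.
- have mE D : measurable D ->
      measurable_fun D (EFin \o (fun x : R => expR (- (2^-1 * x)))).
    move=> mD; apply: measurable_funTS; apply/measurable_EFinP.
    by apply: measurableT_comp => //; exact: measurableT_comp.
  apply: (@le_lt_trans _ _ (\int[mu]_(x in `[1%R, +oo[) (C%:E * (expR (- (2^-1 * x)))%:E))%E).
    apply: ge0_le_integral => //=.
    + by move=> x _; rewrite lee_fin gammaf_ge0.
    + exact: mg.
    + by apply: measurable_funeM; exact: mE.
    + move=> x; rewrite in_itv/= andbT => /leC h; rewrite -EFinM lee_fin.
      have -> : - (2^-1 * x) = x / 2 + - x by field.
      by rewrite expRD mulrA ler_wpM2r ?expR_ge0.
  rewrite ge0_integralZl_EFin//; [|exact: mE|exact: ltW].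
  apply: (@le_lt_trans _ _ (C%:E * \int[mu]_(x in `]0%R, +oo[) (expR (- (2^-1 * x)))%:E)%E).
    apply: lee_wpmul2l; first by rewrite lee_fin ltW.
    apply: ge0_subset_integral => //=; first exact: mE.
    by move=> x /=; rewrite !in_itv/= !andbT => /(lt_le_trans ltr01).
  by rewrite integral_expRN ?invr_gt0// -EFinM ltry.
Qed.

Lemma EFin_Gamma s : 0 < s ->
  (Gamma s)%:E = (\int[mu]_(x in `]0%R, +oo[) (x `^ (s - 1) * expR (- x))%:E)%E.
Proof.
move=> s0; rewrite /Gamma /Rintegral fineK// ge0_fin_numE ?Gamma_lty//.
by apply: integral_ge0 => x _; rewrite lee_fin gammaf_ge0.
Qed.

Lemma Gamma1 : Gamma (1 : R) = 1.
Proof.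
apply/EFin_inj; rewrite EFin_Gamma//.
rewrite -[in RHS]invr1 -integral_expRN//; apply: eq_integral => x _.
by rewrite subrr powRr0 !mul1r.
Qed.

(** On the unit interval ]c, c + 1[ the integrand x^s exp(- x) / x is at least the left-hand side.
    As [c] is arbitrary, Gamma outgrows every exponential, which later gives the Mittag-Leffler
    series an infinite radius of convergence. *)
Lemma Gamma_ge s c : 0 < s -> 0 < c ->
  c `^ s * (expR (- (c + 1)) / (c + 1)) <= Gamma s.
Proof.
move=> s0 c0; rewrite -lee_fin EFin_Gamma//.
set K := c `^ s * _; have c1 : 0 < c + 1 by rewrite addr_gt0.
have mg (D : set R) : measurable D ->
    measurable_fun D (EFin \o (fun x => x `^ (s - 1) * expR (- x))).
  by move=> mD; apply: measurable_funTS; apply/measurable_EFinP; exact: measurable_gammaf.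
apply: (@le_trans _ _ (\int[mu]_(x in `]c, (c + 1)%R[) (x `^ (s - 1) * expR (- x))%:E)%E); last first.
  apply: ge0_subset_integral => //=; first exact: mg.
    by move=> x _; rewrite lee_fin gammaf_ge0.
  by move=> x /=; rewrite !in_itv/= andbT => /andP[+ _]; exact: lt_trans.
have -> : K%:E = (\int[mu]_(x in `]c, (c + 1)%R[) cst K%:E x)%E.
  rewrite integral_cst//= lebesgue_measure_itv/= lte_fin ltrDl ltr01.
  by rewrite -EFinD addrAC subrr add0r mule1.
apply: ge0_le_integral => //=.
- by move=> x _; rewrite lee_fin mulr_ge0 ?powR_ge0// divr_ge0 ?expR_ge0// ltW.
- exact: mg.
- move=> x; rewrite in_itv/= => /andP[cx xc]; rewrite lee_fin.
  have x0 : 0 < x by exact: lt_trans cx.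
  rewrite powRB ?(gt_eqF x0) ?implybT// powRr1 ?(ltW x0)// -mulrA /K.
  apply: ler_pM; rewrite ?powR_ge0// ?divr_ge0 ?expR_ge0 ?(ltW c1)//.
    by apply: ge0_ler_powR; rewrite ?nnegrE ltW.
  rewrite mulrC; apply: ler_pM; rewrite ?invr_ge0 ?expR_ge0 ?(ltW c1)//.
    by rewrite lef_pV2 ?posrE// ltW.
  by rewrite ler_expR lerN2 ltW.
Qed.

Lemma Gamma_gt0 s : 0 < s -> 0 < Gamma s.
Proof.
move=> s0; apply: lt_le_trans (Gamma_ge _ 1 s0 ltr01).
by rewrite mulr_gt0 ?powR_gt0// divr_gt0 ?expR_gt0// addr_gt0.
Qed.

End gamma.

(** * The Beta integral *)

Section beta.
Context {R : realType}.
Notation mu := (@lebesgue_measure R).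
Implicit Types p q s t x c : R.

(** Tonelli's theorem for [g] cut off outside the triangle 0 < x < v with [v] below [b]. The
    abstract bound [b] serves the half-line in the Beta integral and the bounded interval in the
    balayage. *)
Lemma tonelli_triangle (g : R * R -> R) (b : itv_bound R) :
  measurable_fun setT g -> (forall z, 0 <= g z) ->
  (\int[mu]_(x in [set` Interval (BRight 0%R) b])
     \int[mu]_(v in [set` Interval (BRight x) b]) (g (x, v))%:E =
   \int[mu]_(v in [set` Interval (BRight 0%R) b])
     \int[mu]_(x in `]0%R, v[) (g (x, v))%:E)%E.
Proof.
move=> mg g0.
pose E : set (R * R) := [set z | [/\ 0 < z.1, z.1 < z.2 & z.2 \in Interval -oo%O b]].
have mE : measurable E.
  have -> : E = (fst @^-1` `]0, +oo[%classic) `&`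
      ((fun z : R * R => z.2 - z.1) @^-1` `]0, +oo[%classic) `&`
      (snd @^-1` [set` Interval -oo%O b]).
    apply/seteqP; split => [[x v] [/= x0 xv vb]|[x v] [[]]] /=.
      by rewrite !in_itv/= !andbT subr_gt0.
    by rewrite !in_itv/= !andbT subr_gt0.
  apply: measurableI; first apply: measurableI.
  - by rewrite -[X in measurable X]setTI; exact: measurable_fst.
  - rewrite -[X in measurable X]setTI.
    exact: (measurable_funB measurable_snd measurable_fst).
  - by rewrite -[X in measurable X]setTI; exact: measurable_snd.
have mf : measurable_fun setT ((EFin \o g) \_ E).
  apply/(measurable_restrictT _ mE); apply: measurable_funTS.
  exact/measurable_EFinP.
have f0 z : (0 <= ((EFin \o g) \_ E) z)%E.
  by apply: erestrict_ge0 => y _; rewrite lee_fin.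
have memE x v : ((x, v) \in E) = [&& 0 < x, x < v & v \in Interval -oo%O b].
  by apply/idP/idP; rewrite inE => /and3P.
have memb x v : x < v -> v \in Interval -oo%O b -> x \in Interval -oo%O b.
  by move=> xv; rewrite !itv_boundlr/=; apply: le_trans; rewrite bnd_simp ltW.
have meml y x : x \in Interval (BRight y) b = (y < x) && (x \in Interval -oo%O b).
  by rewrite !itv_boundlr/= bnd_simp.
have := @fubini_tonelli _ _ (measurableTypeR R) (measurableTypeR R) R mu mu _ mf f0.
rewrite [in X in _ -> X = _]integral_mkcond [in X in _ -> _ = X]integral_mkcond.
move=> fE; transitivity (\int[mu]_x \int[mu]_y ((EFin \o g) \_ E) (x, y))%E.
  apply: eq_integral => x _; rewrite patchE; case: ifPn.
    rewrite inE/= meml => /andP[x0 xb].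
    rewrite integral_mkcond; apply: eq_integral => v _.
    by rewrite !patchE memE x0/= mem_setE meml.
  rewrite mem_setE meml => xb; rewrite integral0_eq// => v _.
  rewrite patchE memE; case: ifPn => // /and3P[x0 xv vb].
  by move: xb; rewrite x0 (memb _ _ xv vb).
rewrite {}fE; apply: eq_integral => v _; rewrite patchE; case: ifPn.
  rewrite inE/= meml => /andP[v0 vb].
  rewrite [in RHS]integral_mkcond; apply: eq_integral => x _.
  by rewrite !patchE memE vb andbT mem_setE in_itv.
rewrite mem_setE meml => vb; rewrite integral0_eq// => x _.
rewrite patchE memE; case: ifPn => // /and3P[x0 xv vb'].
by move: vb; rewrite (lt_trans x0 xv) vb'.
Qed.

Lemma measurable_funB1 x : measurable_fun setT (fun y : R => x - y).
Proof. exact: measurable_funB. Qed.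

(** After the substitution of [t * x] for [x], the two powers contribute t^(p-1) and t^(q-1), and
    the Jacobian one more factor [t]. *)
Lemma integral_beta_scale p q t : 0 < t ->
  (\int[mu]_(x in `]0%R, t[) (x `^ (p - 1) * (t - x) `^ (q - 1))%:E =
   (t `^ (p + q - 1))%:E *
   \int[mu]_(x in `]0%R, 1%R[) (x `^ (p - 1) * (1 - x) `^ (q - 1))%:E)%E.
Proof.
move=> t0.
have -> : (\int[mu]_(x in `]0%R, t[) (x `^ (p - 1) * (t - x) `^ (q - 1))%:E =
   \int[mu]_(x in `]0%R, 1%R[)
      ((t * x) `^ (p - 1) * (t - t * x) `^ (q - 1) * t)%:E)%E.
  apply: (@ge0_integration_by_substitution_exhaustion R (fun x => t * x)
    (cst t) (fun x => x `^ (p - 1) * (t - x) `^ (q - 1)) `]0, 1[ `]0, t[ _ _).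
  - exact: itv_open.
  - exact: exhaustion_oo.
  - exact: interval_is_interval.
  - by move=> x y _ _ xy; rewrite ltr_pM2l.
  - move=> x _.
    rewrite (_ : (fun _ => _) = (fun z => t *: z))//.
    by apply: is_derive_eq; rewrite /GRing.scale/= mulr1.
  - by move=> x _; exact: cst_continuous.
  - by move=> x _; rewrite ltW.
  - by move=> x /= /[!in_itv]/= /andP[x0 x1]; rewrite mulr_gt0//= gtr_pMr.
  - move=> y /= /[!in_itv]/= /andP[y0 yt]; exists (y / t).
      by rewrite /= in_itv/= divr_gt0//= ltr_pdivrMr// mul1r.
    by rewrite mulrC divfK// gt_eqF.
  - move=> y /= /[!in_itv]/= /andP[y0 yt]; apply: continuousM.
      exact: powR_continuous.
    apply: (@continuous_comp _ _ _ (fun y => t - y) (fun y => y `^ (q - 1))).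
      by apply: continuousB => //; exact: cst_continuous.
    by apply: powR_continuous; rewrite subr_gt0.
  - by move=> y _; rewrite mulr_ge0 ?powR_ge0.
rewrite -ge0_integralZl_EFin//=; last 3 first.
- by move=> x _; rewrite lee_fin mulr_ge0 ?powR_ge0.
- apply: measurable_funTS; apply/measurable_EFinP; apply: measurable_funM.
    exact: measurable_fun_powR_comp.
  by apply: measurable_fun_powR_comp; exact: measurable_funB1.
- exact: powR_ge0.
apply: eq_integral => x; rewrite inE/= in_itv/= => /andP[x0 x1].
rewrite -EFinM; congr EFin.
have -> : t - t * x = t * (1 - x) by ring.
have x1' : 0 <= 1 - x by rewrite subr_ge0 ltW.
rewrite !powRM ?(ltW t0) ?(ltW x0)//.
have -> : t `^ (p + q - 1) = t `^ (p - 1) * t `^ (q - 1) * t.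
  rewrite -{4}(@powRr1 _ t) ?ltW// -!powRD ?(gt_eqF t0) ?implybT//.
  by congr (t `^ _); ring.
ring.
Qed.

Lemma integral_oy_shift (G : R -> R) x :
  (forall y, 0 < y -> {for y, continuous G}) -> (forall y, 0 <= G y) ->
  (\int[mu]_(y in `]0%R, +oo[) (G y)%:E = \int[mu]_(v in `]x, +oo[) (G (v - x))%:E)%E.
Proof.
move=> cG G0; symmetry.
have -> : (\int[mu]_(y in `]0%R, +oo[) (G y)%:E =
           \int[mu]_(y in `]0%R, +oo[) (G ((y + x) - x) * cst 1 y)%:E)%E.
  by apply: eq_integral => y _; rewrite addrK mulr1.
apply: (@ge0_integration_by_substitution_exhaustion R (fun y => y + x)
    (cst 1) (fun v => G (v - x)) `]0, +oo[ `]x, +oo[ _ _).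
- exact: rray_open.
- exact: exhaustion_oy.
- exact: interval_is_interval.
- by move=> u v _ _; rewrite ltrD2r.
- by move=> u _; apply: is_derive_eq; rewrite addr0.
- by move=> u _; exact: cst_continuous.
- by [].
- by move=> u /= /[!in_itv]/= /[!andbT] u0; rewrite ltrDr.
- move=> v /= /[!in_itv]/= /[!andbT] xv; exists (v - x); last by rewrite subrK.
  by rewrite /= in_itv/= subr_gt0 xv.
- move=> v /= /[!in_itv]/= /[!andbT] xv.
  apply: (@continuous_comp _ _ _ (fun v => v - x) G).
    by apply: continuousB => //; exact: cst_continuous.
  by apply: cG; rewrite subr_gt0.
- by [].
Qed.

(** The product of the two Gamma integrals, with v = x + y in the inner one, is the double integral
    of x^(p-1) (v - x)^(q-1) exp(- v) over 0 < x < v. Exchanging the order and scaling the integral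
    in x to ]0, 1[ yields the Beta integral times Gamma(p + q). *)
Lemma Gamma_beta p q : 0 < p -> 0 < q ->
  (\int[mu]_(x in `]0%R, 1%R[) (x `^ (p - 1) * (1 - x) `^ (q - 1))%:E =
   (Gamma p * Gamma q / Gamma (p + q))%:E)%E.
Proof.
move=> p0 q0; set B := (X in X = _).
have pq0 : 0 < p + q by rewrite addr_gt0.
have B0 : (0 <= B)%E.
  by apply: integral_ge0 => x _; rewrite lee_fin mulr_ge0 ?powR_ge0.
suff : (Gamma p * Gamma q)%:E = (B * (Gamma (p + q))%:E)%E.
  move=> e; rewrite EFinM e -muleA -EFinM divff ?mule1// gt_eqF//.
  exact: Gamma_gt0.
pose g (z : R * R) := z.1 `^ (p - 1) * (z.2 - z.1) `^ (q - 1) * expR (- z.2).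
have g0 z : 0 <= g z by rewrite !mulr_ge0 ?powR_ge0 ?expR_ge0.
have mg : measurable_fun setT g.
  apply: measurable_funM; first apply: measurable_funM.
  - by apply: measurable_fun_powR_comp; exact: measurable_fst.
  - apply: measurable_fun_powR_comp.
    exact: (measurable_funB measurable_snd measurable_fst).
  - apply: measurableT_comp => //; apply: measurableT_comp => //.
transitivity (\int[mu]_(x in `]0%R, +oo[) \int[mu]_(v in `]x, +oo[) (g (x, v))%:E)%E.
  rewrite mulrC EFinM (EFin_Gamma _ p0) -ge0_integralZl_EFin//=; last 3 first.
  - by move=> x _; rewrite lee_fin mulr_ge0 ?powR_ge0 ?expR_ge0.
  - by apply: measurable_funTS; apply/measurable_EFinP; exact: measurable_gammaf.
  - by rewrite ltW// Gamma_gt0.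
  apply: eq_integral => x; rewrite inE/= in_itv/= andbT => x0.
  rewrite (EFin_Gamma _ q0) (@integral_oy_shift _ x); last 2 first.
  - move=> y y0; apply: continuousM; first exact: powR_continuous.
    apply: (@continuous_comp _ _ _ -%R expR); last exact: continuous_expR.
    exact: opp_continuous.
  - by move=> y; rewrite mulr_ge0 ?powR_ge0 ?expR_ge0.
  rewrite muleC -ge0_integralZl_EFin//=; last 3 first.
  - by move=> y _; rewrite lee_fin mulr_ge0 ?powR_ge0 ?expR_ge0.
  - apply: measurable_funTS; apply/measurable_EFinP.
    apply: (measurableT_comp (measurable_gammaf q)).
    exact: measurable_funB.
  - by rewrite mulr_ge0 ?powR_ge0 ?expR_ge0.
  apply: eq_integral => v _; rewrite -EFinM /g/=; congr EFin.
  have -> : - v = - x + - (v - x) by ring.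
  by rewrite expRD; ring.
rewrite tonelli_triangle// (EFin_Gamma _ pq0) muleC.
rewrite -ge0_integralZr//=; last 2 first.
- by apply: measurable_funTS; apply/measurable_EFinP; exact: measurable_gammaf.
- by move=> x _; rewrite lee_fin mulr_ge0 ?powR_ge0 ?expR_ge0.
apply: eq_integral => v; rewrite inE/= in_itv/= andbT => v0.
rewrite mulrC EFinM -muleA -integral_beta_scale// -ge0_integralZl_EFin//=; last 2 first.
- by move=> x _; rewrite lee_fin mulr_ge0 ?powR_ge0.
- apply: measurable_funTS; apply/measurable_EFinP; apply: measurable_funM.
    exact: measurable_fun_powR_comp.
  by apply: measurable_fun_powR_comp; exact: measurable_funB1.
by apply: eq_integral => x _; rewrite /g/= -EFinM mulrC.
Qed.

Lemma integral_beta p q t : 0 < p -> 0 < q -> 0 < t ->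
  (\int[mu]_(x in `]0%R, t[) (x `^ (p - 1) * (t - x) `^ (q - 1))%:E =
   (t `^ (p + q - 1) * (Gamma p * Gamma q / Gamma (p + q)))%:E)%E.
Proof. by move=> p0 q0 t0; rewrite integral_beta_scale// Gamma_beta. Qed.

End beta.

(** * Balayage for the Abel kernel *)

Section balayage.
Context {R : realType}.
Notation mu := (@lebesgue_measure R).
Implicit Types a s t r x y : R.

(** This is the balayage formula for a unit mass at [s], up to a constant: the Abel kernel issued
    from [s], integrated against the sweeping density on ]s, t0[, reproduces the kernel at [t1]. *)
Lemma integral_moebius a s t0 t1 : 0 < a < 1 -> s < t0 -> t0 < t1 ->
  (\int[mu]_(r in `]s, t0[)
     ((r - s) `^ (a - 1) * ((t0 - r) `^ (- a) * (t1 - r) `^ (-1)))%:E =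
   (Gamma a * Gamma (1 - a) * ((t1 - s) `^ (a - 1) * (t1 - t0) `^ (- a)))%:E)%E.
Proof.
move=> /andP[a0 a1] st0 t01.
have D0 : 0 < t0 - s by rewrite subr_gt0.
have W0 : 0 < t1 - t0 by rewrite subr_gt0.
have E0 : 0 < t1 - s by rewrite subr_gt0 (lt_trans st0).
pose K := (t1 - t0) / (t0 - s).
have K0 : 0 < K by rewrite divr_gt0.
(* [F] is the Moebius map with [F s = 0], [F t0 = 1] and pole [t1]; it turns
   the integral into the Beta integral of parameters [a] and [1 - a]. *)
pose F r := K * ((t1 - s) / (t1 - r) - 1).
pose dF r := K * ((t1 - s) * (t1 - r) ^- 2).
pose G y := y `^ (a - 1) * (1 - y) `^ (1 - a - 1).
have zE r : r < t0 -> t1 - r != 0.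
  by move=> rt0; rewrite gt_eqF// subr_gt0 (lt_trans rt0).
have FE r : r < t0 -> F r = (r - s) * (t1 - t0) / ((t0 - s) * (t1 - r)).
  move=> /zE z0; rewrite /F /K; field; rewrite z0/=; exact: lt0r_neq0.
have FE1 r : r < t0 -> 1 - F r = (t0 - r) * (t1 - s) / ((t0 - s) * (t1 - r)).
  move=> /zE z0; rewrite /F /K; field; rewrite z0/=; exact: lt0r_neq0.
have cz r : {for r, continuous (fun r => t1 - r)}.
  by apply: continuousB => //; exact: cst_continuous.
have sub : (\int[mu]_(y in `]0%R, 1%R[) (G y)%:E =
    \int[mu]_(r in `]s, t0[) (G (F r) * dF r)%:E)%E.
  apply: (@ge0_integration_by_substitution_exhaustion R F dF G `]s, t0[ `]0, 1[ _ _).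
  - exact: itv_open.
  - exact: exhaustion_oo.
  - exact: interval_is_interval.
  - move=> x y /[!inE]/= /[!in_itv]/= /andP[sx xt] /andP[sy yt] xy.
    rewrite /F ltr_pM2l// ltrD2r ltr_pM2l// ltf_pV2 ?posrE ?subr_gt0 ?(lt_trans _ t01)//.
    by rewrite ltrD2l ltrN2.
  - move=> r /= /[!in_itv]/= /andP[sr rt].
    have d1 : is_derive r (1 : R) (fun r => t1 - r) (- 1).
      have d := is_deriveB (is_derive_cst t1 r (1 : R)) (is_derive_id r (1 : R)).
      by apply: (@is_derive_eq _ _ _ _ _ _ _ _ d); rewrite sub0r.
    have d2 := @is_deriveV _ (fun r => t1 - r) _ _ _ (zE _ rt) d1.
    have d3 := is_deriveZ (K * (t1 - s)) d2.
    have d4 := is_deriveB d3 (is_derive_cst K r (1 : R)).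
    rewrite (_ : F = (K * (t1 - s) \*: (fun r => (t1 - r)^-1)) - cst K); last first.
      by apply/funext => z; rewrite /F !fctE/= /GRing.scale/=; ring.
    apply: (@is_derive_eq _ _ _ _ _ _ _ _ d4).
    by rewrite /dF /GRing.scale/= subr0 mulrN1 opprK; ring.
  - move=> r /= /[!in_itv]/= /andP[sr rt].
    apply: continuousM; first exact: cst_continuous.
    apply: continuousM; first exact: cst_continuous.
    apply: continuousV; first by rewrite expf_neq0// zE.
    by apply: (@continuous_comp _ _ _ (fun r => t1 - r) (fun x => x ^+ 2)) => //; exact: exprn_continuous.
  - by move=> r _; rewrite /dF !mulr_ge0 ?invr_ge0 ?sqr_ge0// ltW.
  - move=> r /= /[!in_itv]/= /andP[sr rt].
    have z0 : 0 < t1 - r by rewrite subr_gt0 (lt_trans rt).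
    rewrite -[X in _ && X]subr_gt0 FE1// FE//.
    by rewrite !divr_gt0 ?mulr_gt0// subr_gt0.
  - move=> y /= /[!in_itv]/= /andP[y0 y1].
    pose w := 1 + y / K; have yK : 0 < y / K by rewrite divr_gt0.
    have w0 : 0 < w by rewrite addr_gt0.
    exists (t1 - (t1 - s) / w); last first.
      rewrite /F subKr invf_div [X in K * (X - 1)]mulrC divfK ?(gt_eqF E0)// /w.
      by rewrite [1 + _]addrC addrK mulrC divfK// gt_eqF.
    rewrite /= in_itv/= ltrBrDr -ltrBrDl ltr_pdivrMr// ltr_pMr//.
    rewrite ltrDl yK/= ltrBlDr -ltrBlDl ltr_pdivlMr//.
    rewrite /w mulrDr mulr1 (_ : (t1 - t0) * (y / K) = y * (t0 - s)); last first.
      by rewrite /K; field; rewrite !gt_eqF.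
    rewrite -ltrBrDl (_ : t1 - s - (t1 - t0) = t0 - s); last by ring.
    by rewrite gtr_pMl.
  - move=> y /= /[!in_itv]/= /andP[y0 yt]; apply: continuousM.
      exact: powR_continuous.
    apply: (@continuous_comp _ _ _ (fun y => 1 - y) (fun y => y `^ (1 - a - 1))).
      by apply: continuousB => //; exact: cst_continuous.
    by apply: powR_continuous; rewrite subr_gt0.
  - by move=> y _; rewrite mulr_ge0 ?powR_ge0.
have := Gamma_beta _ _ a0 (_ : 0 < 1 - a).
rewrite subr_gt0 => /(_ a1).
rewrite (_ : a + (1 - a) = 1); last by ring.
rewrite Gamma1 divr1 -/G => GB.
pose h r := (r - s) `^ (a - 1) * ((t0 - r) `^ (- a) * (t1 - r) `^ (-1)).
have c0 : 0 < (t1 - s) `^ (a - 1) * (t1 - t0) `^ (- a) by rewrite mulr_gt0 ?powR_gt0.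
set c := (t1 - s) `^ (a - 1) * _ in c0 *.
have ch : (\int[mu]_(r in `]s, t0[) (G (F r) * dF r)%:E =
           c^-1%:E * \int[mu]_(r in `]s, t0[) (h r)%:E)%E.
  rewrite -ge0_integralZl_EFin//=; last 3 first.
  - by move=> r _; rewrite lee_fin !mulr_ge0 ?powR_ge0.
  - apply: measurable_funTS; apply/measurable_EFinP; apply: measurable_funM.
      by apply: measurable_fun_powR_comp; exact: measurable_funB.
    by apply: measurable_funM; apply: measurable_fun_powR_comp; exact: measurable_funB1.
  - by rewrite invr_ge0 ltW.
  apply: eq_integral => r; rewrite inE/= in_itv/= => /andP[sr rt].
  rewrite -EFinM /c; congr EFin.
  rewrite /G FE1// FE// /dF /K /h.
  have : 0 < r - s by rewrite subr_gt0.
  have : 0 < t0 - r by rewrite subr_gt0.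
  have : 0 < t1 - r by rewrite subr_gt0 (lt_trans rt).
  (* Each of the six positive differences is written as the exponential of its logarithm, so that
     the identity between powers becomes a ring identity between exponents. *)
  move: D0 W0 E0; rewrite -!lnK_eq => /eqP<- /eqP<- /eqP<- /eqP<- /eqP<- /eqP<-.
  rewrite -expRM_natr -!expRN -!expRD -!expRN -!expRD -!expRM -!expRD -!expRN -!expRD.
  by congr expR; ring.
rewrite mulrC EFinM -GB [X in (_ * X)%E]sub ch muleA -EFinM divff ?mul1e//.
by rewrite gt_eqF.
Qed.

(** The Abel integral at [t1] of a function living on [0, t0] is a mean, of total mass below one, of
    its Abel integrals at the points of [0, t0]. For each fixed [s] this is [integral_moebius];
    Tonelli's theorem then allows integration against [psi]. *)
Lemma balayage a t0 t1 : 0 < a < 1 -> 0 < t0 -> t0 < t1 ->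
  exists P : R -> R, [/\ measurable_fun setT P, forall r, 0 <= P r,
    exists2 q, q < 1 & (\int[mu]_(r in `]0%R, t0[) (P r)%:E = q%:E)%E &
    forall psi : R -> R, measurable_fun setT psi -> (forall s, 0 <= psi s) ->
    (\int[mu]_(s in `]0%R, t0[) ((t1 - s) `^ (a - 1) * psi s)%:E =
     \int[mu]_(r in `]0%R, t0[)
       ((P r)%:E * \int[mu]_(s in `]0%R, r[) ((r - s) `^ (a - 1) * psi s)%:E))%E].
Proof.
move=> a01 t00 t01; have /andP[a0 a1] := a01.
pose C := Gamma a * Gamma (1 - a).
have C0 : 0 < C by rewrite mulr_gt0// Gamma_gt0// subr_gt0.
have W0 : 0 < t1 - t0 by rewrite subr_gt0.
have t10 : 0 < t1 by exact: lt_trans t01.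
(* The constant cancels the factors [C] and (t1 - t0)^(-a) produced by [integral_moebius]. *)
pose c := (t1 - t0) `^ a / C.
have c0 : 0 < c by rewrite divr_gt0// powR_gt0.
pose k r := (t0 - r) `^ (- a) * (t1 - r) `^ (-1).
have k0 r : 0 <= k r by rewrite mulr_ge0 ?powR_ge0.
have mk : measurable_fun setT k.
  by apply: measurable_funM; apply: measurable_fun_powR_comp; exact: measurable_funB1.
have WK : (t1 - t0) `^ a * (t1 - t0) `^ (- a) = 1.
  by rewrite powRN divff// gt_eqF// powR_gt0.
have key s : 0 <= s -> s < t0 ->
    (\int[mu]_(r in `]s, t0[) (c * ((r - s) `^ (a - 1) * k r))%:E =
     ((t1 - s) `^ (a - 1))%:E)%E.
  move=> s0 st0; under eq_integral do rewrite EFinM.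
  rewrite ge0_integralZl_EFin//=; last 3 first.
  - by move=> r _; rewrite lee_fin mulr_ge0 ?powR_ge0.
  - apply: measurable_funTS; apply/measurable_EFinP; apply: measurable_funM => //.
    by apply: measurable_fun_powR_comp; exact: measurable_funB.
  - exact: ltW.
  rewrite integral_moebius// -EFinM -/C; congr EFin.
  transitivity (C / C * ((t1 - t0) `^ a * (t1 - t0) `^ (- a)) * (t1 - s) `^ (a - 1)).
    by rewrite /c; ring.
  by rewrite WK divff ?gt_eqF// !mul1r.
clearbody c k; exists (fun r => c * k r); split.
- exact: measurable_funM.
- by move=> r; rewrite mulr_ge0// ltW.
- pose q := fine (\int[mu]_(r in `]0%R, t0[) (c * k r)%:E)%E.
  (* This is (t0 / t1)^(1 - a), hence less than one. *)
  pose q' := t0 `^ (1 - a) * t1 `^ (a - 1).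
  (* The mass of [P] is bounded by the Moebius integral at [s = 0], since
     [1 <= t0 `^ (1 - a) * r `^ (a - 1)] for [r <= t0]. *)
  have q'1 : q' < 1.
    rewrite /q' -(@ltr_pM2r _ (t1 `^ (1 - a))) ?powR_gt0// -mulrA -powRD; last first.
      by rewrite (gt_eqF t10) implybT.
    rewrite (_ : a - 1 + (1 - a) = 0) ?powRr0 ?mulr1 ?mul1r; last by ring.
    by apply: gt0_ltr_powR; rewrite ?nnegrE ?subr_gt0 ?ltW.
  have le : (\int[mu]_(r in `]0%R, t0[) (c * k r)%:E <= q'%:E)%E.
    have -> : q'%:E = ((t0 `^ (1 - a))%:E * \int[mu]_(r in `]0%R, t0[)
        (c * ((r - 0) `^ (a - 1) * k r))%:E)%E.
      by rewrite key// subr0.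
    rewrite -ge0_integralZl_EFin//=; last 3 first.
    + by move=> r _; rewrite lee_fin !mulr_ge0 ?powR_ge0// ltW.
    + apply: measurable_funTS; apply/measurable_EFinP; apply: measurable_funM => //.
      apply: measurable_funM => //.
      by apply: measurable_fun_powR_comp; exact: measurable_funB.
    + exact: powR_ge0.
    apply: ge0_le_integral => //=.
    + by move=> r _; rewrite lee_fin mulr_ge0// ltW.
    + by apply: measurable_funTS; apply/measurable_EFinP; apply: measurable_funM.
    + apply: measurable_funTS; apply/measurable_EFinP; apply: measurable_funM => //.
      apply: measurable_funM => //; apply: measurable_funM => //.
      by apply: measurable_fun_powR_comp; exact: measurable_funB.
    + move=> r; rewrite in_itv/= => /andP[r0 rt0]; rewrite -EFinM lee_fin subr0.
      rewrite mulrCA ler_pM2l// mulrA ler_peMl//.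
      rewrite -(@ler_pM2r _ (r `^ (1 - a))) ?powR_gt0// -mulrA -powRD; last first.
        by rewrite (gt_eqF r0) implybT.
      rewrite (_ : a - 1 + (1 - a) = 0) ?powRr0 ?mulr1 ?mul1r; last by ring.
      by apply: ge0_ler_powR; rewrite ?nnegrE ?subr_ge0 ltW.
  have fin : (\int[mu]_(r in `]0%R, t0[) (c * k r)%:E \is a fin_num)%E.
    rewrite ge0_fin_numE ?(le_lt_trans le) ?ltry//.
    by apply: integral_ge0 => r _; rewrite lee_fin mulr_ge0// ltW.
  exists q; last by rewrite fineK.
  by apply: le_lt_trans q'1; rewrite -lee_fin fineK.
- move=> psi mpsi psi0.
  pose g (z : R * R) := psi z.1 * (c * ((z.2 - z.1) `^ (a - 1) * k z.2)).
  have g0 z : 0 <= g z by rewrite !mulr_ge0 ?powR_ge0// ltW.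
  have mg : measurable_fun setT g.
    apply: measurable_funM; first exact: (measurableT_comp mpsi measurable_fst).
    apply: measurable_funM => //; apply: measurable_funM.
      apply: measurable_fun_powR_comp.
      exact: (measurable_funB measurable_snd measurable_fst).
    exact: (measurableT_comp mk measurable_snd).
  transitivity (\int[mu]_(s in `]0%R, t0[) \int[mu]_(r in `]s, t0[) (g (s, r))%:E)%E.
    apply: eq_integral => s; rewrite inE/= in_itv/= => /andP[s0 st0].
    under [RHS]eq_integral do rewrite /g/= EFinM.
    rewrite ge0_integralZl_EFin//=; last 2 first.
    + by move=> r _; rewrite lee_fin !mulr_ge0 ?powR_ge0// ltW.
    + apply: measurable_funTS; apply/measurable_EFinP; apply: measurable_funM => //.
      apply: measurable_funM => //.
      by apply: measurable_fun_powR_comp; exact: measurable_funB.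
    by rewrite key ?(ltW s0)// mulrC EFinM.
  rewrite tonelli_triangle//; apply: eq_integral => r; rewrite inE/= in_itv/= => /andP[r0 rt0].
  rewrite -ge0_integralZl_EFin//=; last 3 first.
  + by move=> s _; rewrite lee_fin !mulr_ge0 ?powR_ge0// ltW.
  + apply: measurable_funTS; apply/measurable_EFinP; apply: measurable_funM => //.
    by apply: measurable_fun_powR_comp; exact: measurable_funB1.
  + by rewrite mulr_ge0// ltW.
  by apply: eq_integral => s _; rewrite -EFinM /g/=; congr EFin; ring.
Qed.

End balayage.

(** * The minimum principle *)

Section comparison.
Context {R : realType}.
Notation mu := (@lebesgue_measure R).
Implicit Types a s t r x y : R.

(** The Riemann-Liouville integral of order [a] without its factor [(Gamma a)^-1], in the form that
    occurs in [caputo_solution]. *)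
Definition abel a (phi : R -> R) t : R :=
  Rintegral mu `[0, t] (fun s => (t - s) `^ (a - 1) * phi s).

Lemma measurable_abel_kernel a t (phi : R -> R) : measurable_fun setT phi ->
  measurable_fun setT (fun s => (t - s) `^ (a - 1) * phi s).
Proof.
move=> mphi; apply: measurable_funM => //.
by apply: measurable_fun_powR_comp; exact: measurable_funB1.
Qed.

(** The Beta integral with p = 1. The quotient of Gamma values equals 1 / a and is left as the Beta
    integral gives it. *)
Lemma integral_abel_kernel a t : 0 < a -> 0 < t ->
  (\int[mu]_(s in `]0%R, t[) ((t - s) `^ (a - 1))%:E =
   (t `^ a * (Gamma a / Gamma (a + 1)))%:E)%E.
Proof.
move=> a0 t0; have := @integral_beta _ _ _ _ ltr01 a0 t0.
rewrite Gamma1 mul1r (_ : 1 + a - 1 = a); last by ring.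
rewrite [1 + a]addrC => <-.
by apply: eq_integral => s _; rewrite subrr powRr0 mul1r.
Qed.

Lemma integrable_abel a t B (phi : R -> R) : 0 < a -> 0 < t ->
  measurable_fun setT phi -> (forall s, 0 < s < t -> `|phi s| <= B) ->
  mu.-integrable `]0, t[ (EFin \o (fun s => (t - s) `^ (a - 1) * phi s)).
Proof.
move=> a0 t0 mphi phiB.
have ik : mu.-integrable `]0, t[ (EFin \o (fun s => (t - s) `^ (a - 1))).
  apply/integrableP; split.
    apply: measurable_funTS; apply/measurable_EFinP.
    by apply: measurable_fun_powR_comp; exact: measurable_funB1.
  under eq_integral do rewrite /= ger0_norm ?powR_ge0//.
  by rewrite integral_abel_kernel// ltry.
apply: le_integrable (integrableZl _ B ik) => //.
- by apply: measurable_funTS; apply/measurable_EFinP; exact: measurable_abel_kernel.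
- move=> s /=; rewrite in_itv/= => /phiB sB.
  rewrite lee_fin !normrM mulrC ler_wpM2r// (le_trans sB)//.
  exact: ler_norm.
Qed.

Lemma abelE a t (phi : R -> R) : measurable_fun setT phi ->
  abel a phi t = Rintegral mu `]0, t[ (fun s => (t - s) `^ (a - 1) * phi s).
Proof.
move=> mphi; rewrite /abel /Rintegral -integral_itv_obnd_cbnd; last first.
  apply: measurable_funTS; apply/measurable_EFinP; exact: measurable_abel_kernel.
rewrite -integral_itv_bndo_bndc//.
apply: measurable_funTS; apply/measurable_EFinP; exact: measurable_abel_kernel.
Qed.

Lemma abel0 a (phi : R -> R) : abel a phi 0 = 0.
Proof. by rewrite /abel set_itv1 Rintegral_set1. Qed.

Lemma continuous_itv_bounded (phi : R -> R) t : 0 <= t -> continuous phi ->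
  exists2 B : R, 0 <= B & forall s, 0 <= s <= t -> `|phi s| <= B.
Proof.
move=> t0 cphi.
have cn : continuous (fun s => `|phi s|).
  by move=> s; apply: cvg_norm; exact: cphi.
have [c _ cB] := EVT_max t0 (continuous_subspaceT cn).
by exists `|phi c| => // s st; apply: cB; rewrite in_itv.
Qed.

Lemma abel_comparison a T y0 (y phi : R -> R) :
  0 < a < 1 -> continuous y -> continuous phi -> 0 <= y0 ->
  (forall t, 0 <= t <= T -> y t = y0 + (Gamma a)^-1 * abel a phi t) ->
  (forall t, 0 <= t <= T -> y t < 0 -> 0 <= phi t) ->
  forall t, 0 <= t <= T -> 0 <= y t.
Proof.
move=> a01 cy cphi y00 yE phi0 t tT; have /andP[a0 a1] := a01.
have T0 : 0 <= T by case/andP: tT => /le_trans; apply.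
have [t1 + ymin] := EVT_min T0 (continuous_subspaceT cy).
rewrite in_itv/= => t1T.
suff yt1 : 0 <= y t1 by apply: (le_trans yt1); apply: ymin; rewrite in_itv.
rewrite leNgt; apply/negP => yt1.
(* At 0 the Abel integral vanishes and [y] takes the value [y0 >= 0]. *)
have t1_gt0 : 0 < t1.
  case/andP : (t1T); rewrite le_eqVlt => /predU1P[t10|//].
  by move: yt1; rewrite -t10 yE ?lexx// abel0 mulr0 addr0 ltNge y00.
have [t0 [t00 t01 yneg]] : exists t0, [/\ 0 < t0, t0 < t1 &
    forall s, t0 <= s <= t1 -> y s < 0].
  have /nbhs_ballP[e /= e0 he] : \forall s \near t1, y s < 0.
    exact: (@cvgr_lt _ _ _ _ y (y t1) (cy t1) 0 yt1).
  (* The first term keeps [t0] positive, the second keeps [t0, t1] inside the ball on which [y] is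
     negative. *)
  exists (Num.max (t1 / 2) (t1 - e / 2)); split.
  - by rewrite lt_max divr_gt0.
  - by rewrite gt_max; apply/andP; split; lra.
  - move=> s /andP[]; rewrite ge_max => /andP[_ es] st1; apply: he.
    by rewrite /ball/= ger0_norm ?subr_ge0//; lra.
have [B B0 phiB] := continuous_itv_bounded _ _ T0 cphi.
have mphi : measurable_fun setT phi by exact: continuous_measurable_fun.
have my : measurable_fun setT y by exact: continuous_measurable_fun.
have t1T' : t1 <= T by case/andP: t1T.
have t0T : t0 <= T by rewrite (le_trans (ltW t01)).
have G0 := Gamma_gt0 _ a0.
have [P [mP P0 [q q1 Pq] balP]] := balayage _ _ _ a01 t00 t01.
(* [balayage] is stated for nonnegative functions; [psi] is [phi + B] on [0, T]. *)
pose psi s := `|phi s + B|.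
have mpsi : measurable_fun setT psi.
  by apply: measurableT_comp => //; exact: measurable_funD.
have psiE s : 0 <= s <= T -> psi s = phi s + B.
  by move=> /phiB; rewrite ler_norml => /andP[? _]; rewrite /psi ger0_norm; lra.
pose b r := r `^ a * (Gamma a / Gamma (a + 1)).
pose k s := (t1 - s) `^ (a - 1).
have iphi r : 0 < r -> r <= T ->
    mu.-integrable `]0, r[ (EFin \o (fun s => (r - s) `^ (a - 1) * phi s)).
  move=> r0 rT; apply: (@integrable_abel _ _ B) => // s /andP[s0 sr].
  by apply: phiB; rewrite (ltW s0) (le_trans (ltW sr)).
have iB r : 0 < r ->
    mu.-integrable `]0, r[ (EFin \o (fun s => (r - s) `^ (a - 1) * B)).
  by move=> r0; apply: (@integrable_abel _ _ B) => // s _; rewrite ger0_norm.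
have cB r : 0 < r -> (\int[mu]_(s in `]0%R, r[) ((r - s) `^ (a - 1) * B)%:E = (b r * B)%:E)%E.
  move=> r0; under eq_integral do rewrite EFinM.
  rewrite ge0_integralZr ?integral_abel_kernel//.
  - apply: measurable_funTS; apply/measurable_EFinP.
    by apply: measurable_fun_powR_comp; exact: measurable_funB1.
  - by move=> s _; rewrite lee_fin powR_ge0.
have psiI r : 0 < r -> r <= T ->
    (\int[mu]_(s in `]0%R, r[) ((r - s) `^ (a - 1) * psi s)%:E =
     (Gamma a * (y r - y0) + b r * B)%:E)%E.
  move=> r0 rT.
  have -> : Gamma a * (y r - y0) = abel a phi r.
    by rewrite yE ?(ltW r0)// [y0 + _]addrC addrK mulrA divff ?gt_eqF// mul1r.
  rewrite EFinD -cB// abelE// /Rintegral fineK; last exact: integrable_fin_num (iphi _ r0 rT).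
  rewrite -integralD//; [|exact: iphi|exact: iB].
  apply: eq_integral => s; rewrite inE/= in_itv/= => /andP[s0 sr].
  by rewrite psiE ?(ltW s0) ?(le_trans (ltW sr))// -EFinD mulrDr.
(* By the equation for [y], [- N] is the value of [abel a phi] at [t1]; as [t1] is a minimum of [y],
   it is also a lower bound of [abel a phi] on [0, T]. *)
pose N := Gamma a * (y0 - y t1).
have N0 : 0 < N by rewrite mulr_gt0// subr_gt0 (lt_le_trans yt1).
have mb : measurable_fun setT b by apply: measurable_funM => //; exact: measurable_fun_powR_comp.
have b0 r : 0 <= b r by rewrite mulr_ge0 ?powR_ge0// divr_ge0// ltW// Gamma_gt0// addr_gt0.
have psiI0 r : 0 < r -> r <= T -> 0 <= Gamma a * (y r - y0) + b r * B.
  move=> r0 rT; rewrite -lee_fin -psiI//.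
  by apply: integral_ge0 => s _; rewrite lee_fin mulr_ge0 ?powR_ge0// /psi.
have mX : measurable_fun setT (fun r => Gamma a * (y r - y0) + b r * B).
  apply: measurable_funD; apply: measurable_funM => //; exact: measurable_funB.
(* Balayage is applied to [B] and to [psi] separately. Their Abel integrals differ by that of [phi],
   which is at least [- N], and [P] has mass [q]. *)
have key : (\int[mu]_(s in `]0%R, t0[) (k s * B)%:E <=
            \int[mu]_(s in `]0%R, t0[) (k s * psi s)%:E + (N * q)%:E)%E.
  rewrite (balP (cst B))// (balP psi)//; last by move=> s; exact: normr_ge0.
  have -> : (\int[mu]_(r in `]0%R, t0[) ((P r)%:E *
      \int[mu]_(s in `]0%R, r[) ((r - s) `^ (a - 1) * cst B s)%:E) =
      \int[mu]_(r in `]0%R, t0[) (P r * (b r * B))%:E)%E.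
    by apply: eq_integral => r; rewrite inE/= in_itv/= => /andP[r0 _]; rewrite cB.
  have -> : (\int[mu]_(r in `]0%R, t0[) ((P r)%:E *
      \int[mu]_(s in `]0%R, r[) ((r - s) `^ (a - 1) * psi s)%:E) =
      \int[mu]_(r in `]0%R, t0[) (P r * (Gamma a * (y r - y0) + b r * B))%:E)%E.
    apply: eq_integral => r; rewrite inE/= in_itv/= => /andP[r0 rt0].
    by rewrite psiI// (le_trans (ltW rt0)).
  have -> : (N * q)%:E = (\int[mu]_(r in `]0%R, t0[) (N * P r)%:E)%E.
    under eq_integral do rewrite EFinM.
    rewrite ge0_integralZl_EFin//=; last 3 first.
    - by move=> r _; rewrite lee_fin.
    - by apply: measurable_funTS; exact/measurable_EFinP.
    - exact: ltW.
    by rewrite Pq.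
  rewrite -ge0_integralD//=; last 4 first.
  - move=> r; rewrite in_itv/= => /andP[r0 rt0]; rewrite lee_fin mulr_ge0//.
    by rewrite psiI0// (le_trans (ltW rt0)).
  - by apply: measurable_funTS; apply/measurable_EFinP; exact: measurable_funM.
  - by move=> r _; rewrite lee_fin mulr_ge0// ltW.
  - by apply: measurable_funTS; apply/measurable_EFinP; exact: measurable_funM.
  apply: ge0_le_integral => //=.
  - by move=> r _; rewrite lee_fin mulr_ge0 ?P0// mulr_ge0 ?b0.
  - apply: measurable_funTS; apply/measurable_EFinP; apply: measurable_funM => //.
    exact: measurable_funM.
  - apply: measurable_funTS; apply/measurable_EFinP.
    by apply: measurable_funD; exact: measurable_funM.
  - move=> r; rewrite in_itv/= => /andP[r0 rt0]; rewrite -EFinD lee_fin.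
    rewrite [N * _]mulrC -mulrDr ler_wpM2l//.
    rewrite addrAC lerDr /N -mulrDr mulr_ge0 ?(ltW G0)//.
    have : y t1 <= y r.
      by apply: ymin; rewrite in_itv/= (ltW r0) (le_trans (ltW rt0)).
    lra.
have sub : `]0, t0[ `<=` (`]0, t1[ : set R).
  by apply: subset_itvl; rewrite bnd_simp ltW.
have ik1 : mu.-integrable `]0, t0[ (EFin \o (fun s => k s * phi s)).
  by apply: (@integrableS _ _ _ mu `]0, t1[ `]0, t0[ _ _ _ _ (iphi _ t1_gt0 t1T')).
have ik2 : mu.-integrable `]0, t0[ (EFin \o (fun s => k s * B)).
  by apply: (@integrableS _ _ _ mu `]0, t1[ `]0, t0[ _ _ _ _ (iB _ t1_gt0)).
(* The integral of [k * B] is finite, so it can be cancelled from [key]. *)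
have low : - (N * q) <= Rintegral mu `]0, t0[ (fun s => k s * phi s).
  move: key.
  have -> : (\int[mu]_(s in `]0%R, t0[) (k s * psi s)%:E =
      \int[mu]_(s in `]0%R, t0[) (k s * phi s)%:E +
      \int[mu]_(s in `]0%R, t0[) (k s * B)%:E)%E.
    rewrite -integralD//; apply: eq_integral => s.
    rewrite inE/= in_itv/= => /andP[s0 st0].
    by rewrite psiE ?(ltW s0) ?(le_trans (ltW st0))// -EFinD mulrDr.
  rewrite -(fineK (integrable_fin_num _ ik1))// -(fineK (integrable_fin_num _ ik2))//.
  rewrite -!EFinD lee_fin /Rintegral /comp; lra.
(* On [t0, t1[ the function [y] is negative, so [phi] is nonnegative there and that part of the
   integral only adds. *)
have up : Rintegral mu `]0, t0[ (fun s => k s * phi s) <= abel a phi t1.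
  rewrite abelE//.
  have E : `]0, t1[%classic = `]0, t0[%classic `|` `[t0, t1[%classic :> set R.
    by rewrite -itv_bndbnd_setU// bnd_simp ltW.
  rewrite [in leRHS]E Rintegral_setU//; last 2 first.
  - by rewrite -E; exact: iphi.
  - apply/disj_setPS => x [/=]; rewrite !in_itv/= => /andP[_ x1] /andP[].
    by rewrite leNgt x1.
  rewrite lerDl; apply: Rintegral_ge0 => s /=; rewrite in_itv/= => /andP[ts st].
  rewrite mulr_ge0 ?powR_ge0//; apply: phi0.
    by rewrite (le_trans (ltW t00) ts)/= (le_trans (ltW st)).
  by apply: yneg; rewrite ts ltW.
have : abel a phi t1 = - N.
  have := yE _ t1T; rewrite /N => ->.
  rewrite mulrBr mulrDr mulrA divff ?(gt_eqF G0)// mul1r; ring.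
(* The two bounds combine to [N <= N * q] with [N > 0], against [q < 1]. *)
move=> aE; move: (le_trans low up); rewrite aE lerN2.
by rewrite ler_pMr// leNgt q1.
Qed.

End comparison.

(** * Linearity, bounds and powers under the Abel integral *)

Section abel_linear.
Context {R : realType}.
Notation mu := (@lebesgue_measure R).
Implicit Types a s t r x y : R.

Lemma integrable_abel_continuous a t (phi : R -> R) : 0 < a -> 0 < t ->
  continuous phi ->
  mu.-integrable `]0, t[ (EFin \o (fun s => (t - s) `^ (a - 1) * phi s)).
Proof.
move=> a0 t0 cphi; have [B _ phiB] := continuous_itv_bounded _ _ (ltW t0) cphi.
apply: (@integrable_abel _ _ _ B) => //; first exact: continuous_measurable_fun.
by move=> s /andP[s0 st]; apply: phiB; rewrite !ltW.
Qed.

Lemma abelDZ a t p (f g : R -> R) : 0 < a -> 0 <= t ->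
  continuous f -> continuous g ->
  abel a (fun s => f s + p * g s) t = abel a f t + p * abel a g t.
Proof.
move=> a0; rewrite le_eqVlt => /predU1P[<-|t0] cf cg.
  by rewrite !abel0 mulr0 addr0.
have mf : measurable_fun setT f by exact: continuous_measurable_fun.
have mg : measurable_fun setT g by exact: continuous_measurable_fun.
rewrite !abelE//; last by apply: measurable_funD => //; exact: measurable_funM.
have if_ := integrable_abel_continuous _ _ _ a0 t0 cf.
have ig := integrable_abel_continuous _ _ _ a0 t0 cg.
rewrite -RintegralZl// -RintegralD//; last exact: (integrableZl _ p ig).
by apply: eq_Rintegral => s _; ring.
Qed.

Lemma abel_le a t e (f : R -> R) : 0 < a -> 0 <= t -> continuous f ->
  (forall s, 0 <= s <= t -> `|f s| <= e) ->
  `|abel a f t| <= e * (t `^ a * (Gamma a / Gamma (a + 1))).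
Proof.
move=> a0; rewrite le_eqVlt => /predU1P[<-|t0] cf fe.
  by rewrite abel0 normr0 powR0 ?gt_eqF// mul0r mulr0.
have mf : measurable_fun setT f by exact: continuous_measurable_fun.
have e0 : 0 <= e by apply: (le_trans (normr_ge0 (f 0))); apply: fe; rewrite lexx ltW.
have if_ := integrable_abel_continuous _ _ _ a0 t0 cf.
rewrite abelE//; apply: (le_trans (le_normr_Rintegral _ if_)) => //.
have ce : continuous (cst e : R -> R) by move=> s; exact: cst_continuous.
have -> : e * (t `^ a * (Gamma a / Gamma (a + 1))) =
    Rintegral mu `]0, t[ (fun s => (t - s) `^ (a - 1) * cst e s).
  have kE : (\int[mu]_(s in `]0%R, t[) ((t - s) `^ (a - 1) * e)%:E =
      (t `^ a * (Gamma a / Gamma (a + 1)) * e)%:E)%E.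
    under eq_integral do rewrite EFinM.
    rewrite ge0_integralZr ?integral_abel_kernel//.
    - apply: measurable_funTS; apply/measurable_EFinP.
      by apply: measurable_fun_powR_comp; exact: measurable_funB1.
    - by move=> s _; rewrite lee_fin powR_ge0.
  by rewrite /Rintegral kE mulrC.
apply: le_Rintegral => //.
- exact: (integrable_norm if_).
- exact: (integrable_abel_continuous _ _ _ a0 t0 ce).
- move=> s /=; rewrite in_itv/= => /andP[s0 st].
  rewrite normrM ger0_norm ?powR_ge0// ler_wpM2l ?powR_ge0// fe//.
  by rewrite !ltW.
Qed.

(* For [s < 0], [s `^ a] is the junk value [1]; the norm restores continuity at [0]. *)
Lemma continuous_norm_powR a : 0 < a -> continuous (fun s : R => `|s| `^ a).
Proof.
move=> a0 s; have [->|s0] := eqVneq s 0; last first.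
  apply: (@continuous_comp _ _ _ (fun s : R => `|s|) (fun x => x `^ a)).
    exact: norm_continuous.
  by apply: powR_continuous; rewrite normr_gt0.
apply/cvgrPdist_lt => e e0; rewrite normr0 powR0 ?gt_eqF//.
have e1 : 0 < e `^ a^-1 by rewrite powR_gt0.
apply/nbhs_ballP; exists (e `^ a^-1) => //= x; rewrite /ball/= sub0r normrN => xe.
rewrite sub0r normrN ger0_norm ?powR_ge0//.
rewrite -[ltRHS](@powRr1 _ e) ?(ltW e0)// -(@mulVf _ a) ?gt_eqF// powRrM.
by apply: gt0_ltr_powR; rewrite ?nnegrE ?normr_ge0 ?(ltW e1).
Qed.

(** The Beta integral with p = a k + 1 and q = a. Once divided by [Gamma a], the Abel integral thus
    maps t^(a k) / Gamma(a k + 1) to the same expression with k + 1. *)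
Lemma abel_norm_powRX a k t : 0 < a -> 0 <= t ->
  abel a (fun s => (`|s| `^ a) ^+ k) t =
  Gamma a * (Gamma (a * k%:R + 1) / Gamma (a * k.+1%:R + 1)) * (t `^ a) ^+ k.+1.
Proof.
move=> a0; rewrite le_eqVlt => /predU1P[<-|t0].
  by rewrite abel0 powR0 ?gt_eqF// expr0n mulr0.
rewrite abelE; last first.
  apply: continuous_measurable_fun => s.
  apply: (@continuous_comp _ _ _ (fun s : R => `|s| `^ a) (fun x => x ^+ k)).
    exact: continuous_norm_powR.
  exact: exprn_continuous.
have p0 : 0 < a * k%:R + 1 by rewrite ltr_wpDl// mulr_ge0// ltW.
rewrite /Rintegral (_ : (\int[mu]_(s in _) _)%E =
   (\int[mu]_(x in `]0%R, t[) (x `^ (a * k%:R + 1 - 1) * (t - x) `^ (a - 1))%:E)%E).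
  rewrite integral_beta//=.
  have -> : a * k%:R + 1 + a = a * k.+1%:R + 1 by rewrite -(natr1 k); ring.
  by rewrite addrK powRrM powR_mulrn ?powR_ge0//; ring.
apply: eq_integral => s; rewrite inE/= in_itv/= => /andP[s0 _].
by rewrite gtr0_norm// addrK powRrM powR_mulrn ?powR_ge0// mulrC.
Qed.

End abel_linear.

(** * The Mittag-Leffler function *)

Section mittag_leffler.
Context {R : realType}.
Implicit Types a s t r x y : R.

(** Equivalent to an infinite radius of convergence, in a form that passes easily to derived
    series. *)
Definition subgeometric (c : nat -> R) :=
  forall rho : R, 0 < rho -> exists2 K, 0 <= K & forall k, `|c k| <= K * rho ^+ k.

(** The coefficients of the derived series carry a factor k + 1 <= 2^(k+1), absorbed by using the
    bound for [c] at [rho / 2]. *)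
Lemma subgeometric_diffs (c : nat -> R) :
  subgeometric c -> subgeometric (pseries_diffs c).
Proof.
move=> sc rho rho0; have rho20 : 0 < rho / 2 by rewrite divr_gt0.
have [K K0 cK] := sc _ rho20.
exists (K * rho); first by rewrite mulr_ge0// ltW.
move=> k; rewrite /pseries_diffs normrM ger0_norm//.
apply: (@le_trans _ _ (2 ^+ k.+1 * (K * (rho / 2) ^+ k.+1))).
  rewrite ler_pM//; first by rewrite -natrX ler_nat ltnW// ltn_expl.
rewrite exprMn exprVn -mulrA -exprS; set n := k.+1.
have -> : 2 ^+ n * (K * (rho ^+ n / 2 ^+ n)) = 2 ^+ n / 2 ^+ n * (K * rho ^+ n) by ring.
by rewrite divff ?mul1r// expf_neq0.
Qed.

Lemma subgeometric_half (c : nat -> R) y : subgeometric c -> 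
  exists2 K, 0 <= K & forall x k, `|x| <= y -> `|c k * x ^+ k| <= K * 2^-1 ^+ k.
Proof.
(* Chosen so that [rho] times a bound of [|x|] is 1/2; the added 1 keeps the denominator
   positive. *)
move=> sc; pose rho := (2 * (`|y| + 1))^-1.
have y0 : 0 < `|y| + 1 by rewrite ltr_wpDl.
have rho0 : 0 < rho by rewrite invr_gt0 mulr_gt0.
have [K K0 cK] := sc _ rho0; exists K => // x k xy.
rewrite normrM normrX; apply: (@le_trans _ _ (K * rho ^+ k * (`|y| + 1) ^+ k)).
  rewrite ler_pM ?exprn_ge0// lerXn2r ?nnegrE ?(ltW y0)//.
  by rewrite (le_trans xy)// (le_trans (ler_norm y))// lerDl.
rewrite -mulrA -exprMn /rho invfM -mulrA mulVf ?gt_eqF// mulr1//.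
Qed.

Lemma subgeometric_cvg (c : nat -> R) x : subgeometric c -> cvgn (pseries c x).
Proof.
move=> sc; have [K K0 cK] := subgeometric_half _ `|x| sc.
apply: normed_cvg; rewrite /normed_series_of/=.
apply: (@series_le_cvg _ _ (geometric K 2^-1)) => //.
- by move=> n; rewrite /geometric/= mulr_ge0// exprn_ge0// invr_ge0.
- by move=> n; rewrite /geometric/=; exact: cK.
- apply: is_cvg_geometric_series; rewrite ger0_norm ?invr_ge0//; lra.
Qed.

(** A power series is differentiable at [x] once it and its first two derived series converge at a
    point beyond [|x|], here [|x| + 1]. *)
Lemma subgeometric_continuous (c : nat -> R) : subgeometric c ->
  continuous (fun x => limn (pseries c x)).
Proof.
move=> sc x; apply: differentiable_continuous; apply/derivable1_diffP.
have sc1 := subgeometric_diffs _ sc; have sc2 := subgeometric_diffs _ sc1.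
have [] // := @pseries_snd_diffs R c (`|x| + 1) x
  (subgeometric_cvg _ _ sc) (subgeometric_cvg _ _ sc1) (subgeometric_cvg _ _ sc2) _.
by rewrite [ltRHS]ger0_norm ?ltrDl// addr_ge0.
Qed.

Lemma subgeometric_tail (c : nat -> R) y : subgeometric c ->
  exists2 K, 0 <= K & forall x n, `|x| <= y ->
    `|limn (pseries c x) - pseries c x n| <= K * 2^-1 ^+ n.
Proof.
move=> sc; have [K K0 cK] := subgeometric_half _ y sc.
exists (2 * K); first by rewrite mulr_ge0.
move=> x n xy.
(* The exact value of the geometric sum, with its subtracted last term, is what makes the induction
   on [m] close. *)
have step m : `|pseries c x (m + n)%N - pseries c x n| <=
    2 * K * 2^-1 ^+ n - 2 * K * 2^-1 ^+ (m + n).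
  elim: m => [|m IH]; first by rewrite !add0n !subrr normr0.
  rewrite addSn /pseries seriesSr -/(pseries c x) [X in `|X|](_ : _ =
    c (m + n)%N * x ^+ (m + n) + (pseries c x (m + n)%N - pseries c x n)); last by rewrite /=; ring.
  apply: (le_trans (ler_normD _ _)).
  apply: (le_trans (lerD (cK _ _ xy) IH)).
  by rewrite exprS; lra.
have cv := subgeometric_cvg _ x sc.
have cv' : `|pseries c x (m + n)%N - pseries c x n| @[m --> \oo] -->
    `|limn (pseries c x) - pseries c x n|.
  apply: cvg_norm; apply: cvgB; last exact: cvg_cst.
  by rewrite (@cvg_shiftn n _ (pseries c x)).
rewrite -(cvg_lim _ cv')//; apply: limr_le; first by apply/cvg_ex; eexists; exact: cv'.
near=> m; apply: (le_trans (step m)).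
by rewrite gerBl !mulr_ge0// exprn_ge0// invr_ge0.
Unshelve. all: by end_near.
Qed.

Definition mlcoef a (k : nat) : R := (Gamma (a * k%:R + 1))^-1.

Lemma mittag_lefflerE a x : mittag_leffler a x = limn (pseries (mlcoef a) x).
Proof.
rewrite /mittag_leffler /pseries /series/=; congr (limn _); apply/funext => n.
by apply: eq_bigr => k _; rewrite mulrC.
Qed.

Lemma mlcoef_subgeometric a : 0 < a -> subgeometric (mlcoef a).
Proof.
(* With this choice C^(a k) = rho^(-k), and [Gamma_ge] at [C] bounds Gamma(a k + 1) below by C d
   rho^(-k). *)
move=> a0 rho rho0; pose C := rho `^ (- a^-1).
have C0 : 0 < C by rewrite powR_gt0.
pose d := expR (- (C + 1)) / (C + 1).
have d0 : 0 < d by rewrite divr_gt0 ?expR_gt0// addr_gt0.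
have Gge s : 0 < s -> C `^ s * d <= Gamma s by move=> s0; exact: Gamma_ge.
clearbody d; exists (C * d)^-1; first by rewrite invr_ge0 mulr_ge0// ltW.
move=> k; have p0 : 0 < a * k%:R + 1 by rewrite ltr_wpDl// mulr_ge0// ltW.
have G0 := Gamma_gt0 _ p0.
rewrite /mlcoef ger0_norm ?invr_ge0 ?(ltW G0)//.
rewrite -[leRHS]invrK lef_pV2 ?posrE ?invr_gt0 ?mulr_gt0 ?invr_gt0 ?mulr_gt0 ?exprn_gt0//.
rewrite invfM invrK; apply: le_trans (Gge _ p0).
rewrite powRD ?(gt_eqF C0) ?implybT// powRr1 ?(ltW C0)//.
rewrite {2}/C -powRrM mulNr mulKf ?gt_eqF// powRN powR_mulrn ?(ltW rho0)//.
by rewrite le_eqVlt; apply/orP; left; apply/eqP; ring.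
Qed.

Lemma continuous_mittag_leffler a : 0 < a -> continuous (mittag_leffler a).
Proof.
move=> a0; rewrite (_ : mittag_leffler a = fun x => limn (pseries (mlcoef a) x)).
  by apply: subgeometric_continuous; exact: mlcoef_subgeometric.
by apply/funext => x; exact: mittag_lefflerE.
Qed.

(** The norm extends the solution of the linear comparison equation evenly to the whole line, as the
    lemmas on [abel] speak of functions continuous everywhere. *)
Lemma continuous_mlsol a M : 0 < a ->
  continuous (fun s : R => mittag_leffler a (- (M * `|s| `^ a))).
Proof.
move=> a0 s; apply: (@continuous_comp _ _ _ (fun s => - (M * `|s| `^ a)) (mittag_leffler a)).
  apply: continuousN; apply: continuousM; first exact: cst_continuous.
  exact: continuous_norm_powR.
exact: continuous_mittag_leffler.
Qed.

Let cX a k : 0 < a -> continuous (fun s : R => (`|s| `^ a) ^+ k).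
Proof.
move=> a0 s; apply: (@continuous_comp _ _ _ (fun s : R => `|s| `^ a) (fun x => x ^+ k)).
  exact: continuous_norm_powR.
exact: exprn_continuous.
Qed.

Let mlterm_split a M k s : mlcoef a k * (- (M * `|s| `^ a)) ^+ k =
  (mlcoef a k * (- M) ^+ k) * (`|s| `^ a) ^+ k.
Proof. by rewrite -mulrA -exprMn mulNr. Qed.

Lemma continuous_partial_sum a M m : 0 < a ->
  continuous (fun s : R => pseries (mlcoef a) (- (M * `|s| `^ a)) m).
Proof.
move=> a0; elim: m => [|m IH].
  rewrite (_ : (fun _ => _) = cst 0); first by move=> s; exact: cst_continuous.
  by apply/funext => s; rewrite /pseries /series/= big_geq.
rewrite (_ : (fun _ => _) = (fun s => pseries (mlcoef a) (- (M * `|s| `^ a)) m +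
    (mlcoef a m * (- M) ^+ m) * (`|s| `^ a) ^+ m)).
  move=> s; apply: cvgD; first exact: IH.
  by apply: cvgM; [exact: cvg_cst|exact: cX].
by apply/funext => s; rewrite -mlterm_split /pseries /series/= big_nat_recr.
Qed.

(** By [abel_norm_powRX] the integral moves each term of the series to the next one and the constant
    term 1 is restored; hence [n] terms under the integral give [n.+1] terms outside. *)
Lemma abel_partial_sum a M n t : 0 < a -> 0 <= t ->
  pseries (mlcoef a) (- (M * t `^ a)) n.+1 =
  1 - (Gamma a)^-1 * M * abel a (fun s => pseries (mlcoef a) (- (M * `|s| `^ a)) n) t.
Proof.
move=> a0 t0; have G0 := Gamma_gt0 _ a0.
have psE := mlterm_split a M.
elim: n => [|n IH].
  rewrite (_ : abel _ _ _ = 0).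
    rewrite /pseries /series/= big_nat1 expr0 mulr1 /mlcoef mulr0 add0r Gamma1.
    by rewrite invr1 mulr0 subr0.
  rewrite /abel (_ : (fun _ => _) = (fun=> 0)); last first.
    by apply/funext => s; rewrite /pseries /series/= big_geq// mulr0.
  by rewrite /Rintegral integral0.
rewrite (_ : (fun _ => _) = (fun s => pseries (mlcoef a) (- (M * `|s| `^ a)) n +
    (mlcoef a n * (- M) ^+ n) * (`|s| `^ a) ^+ n)); last first.
  by apply/funext => s; rewrite -psE /pseries /series/= big_nat_recr.
rewrite abelDZ//; [|exact: continuous_partial_sum|exact: cX].
rewrite mulrDr opprD addrA -IH.
rewrite [LHS](_ : _ = pseries (mlcoef a) (- (M * t `^ a)) n.+1 +
   mlcoef a n.+1 * (- (M * t `^ a)) ^+ n.+1); last first.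
  by rewrite /pseries /series/= big_nat_recr.
congr (_ + _); rewrite abel_norm_powRX// /mlcoef -mulNr exprMn.
have p0 : 0 < a * n%:R + 1 by rewrite ltr_wpDl// mulr_ge0// ltW.
have p1 : 0 < a * n.+1%:R + 1 by rewrite ltr_wpDl// mulr_ge0// ltW.
have := Gamma_gt0 _ p0; have := Gamma_gt0 _ p1.
set g1 := Gamma (a * n.+1%:R + 1); set g0 := Gamma (a * n%:R + 1) => g10 g00.
rewrite [(- M) ^+ n.+1]exprS; set X := (- M) ^+ n; set Y := (t `^ a) ^+ _.
by field; rewrite !gt_eqF.
Qed.

(** The limit of [abel_partial_sum]: the partial sums converge uniformly on [0, t], and the Abel
    integral is bounded for the uniform norm. *)
Lemma abel_mittag_leffler a M t : 0 < a -> 0 <= t ->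
  mittag_leffler a (- (M * t `^ a)) =
  1 + (Gamma a)^-1 *
    abel a (fun s => - (M * mittag_leffler a (- (M * `|s| `^ a)))) t.
Proof.
move=> a0 t0; have G0 := Gamma_gt0 _ a0.
have sc := mlcoef_subgeometric _ a0.
pose u s : R := mittag_leffler a (- (M * `|s| `^ a)).
pose S n s : R := pseries (mlcoef a) (- (M * `|s| `^ a)) n.
have cu : continuous u by exact: continuous_mlsol.
have [K K0 tail] := subgeometric_tail _ (`|M| * t `^ a) sc.
have xs s : 0 <= s <= t -> `|- (M * `|s| `^ a)| <= `|M| * t `^ a.
  move=> /andP[s0 st]; rewrite normrN normrM ler_wpM2l// ger0_norm ?powR_ge0//.
  by rewrite ger0_norm//; apply: ge0_ler_powR; rewrite ?nnegrE ?(ltW a0).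
have uS n s : 0 <= s <= t -> `|u s - S n s| <= K * 2^-1 ^+ n.
  by move=> /xs h; rewrite /u mittag_lefflerE; exact: tail.
have tt : 0 <= t <= t by rewrite t0 lexx.
have -> : (fun s => - (M * u s)) = (fun s => cst 0 s + - M * u s).
  by apply/funext => s; rewrite add0r mulNr.
have c0 : continuous (cst 0 : R -> R) by move=> s; exact: cst_continuous.
rewrite abelDZ// [abel a (cst 0) t](_ : _ = 0) ?add0r; last first.
  rewrite /abel (_ : (fun _ => _) = (fun=> 0)); last by apply/funext => s; rewrite mulr0.
  by rewrite /Rintegral integral0.
have -> : - (M * t `^ a) = - (M * `|t| `^ a) by rewrite (ger0_norm t0).
rewrite -/(u t).
pose b := t `^ a * (Gamma a / Gamma (a + 1)).
pose c := (Gamma a)^-1 * M.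
(* The defect on the left is independent of [n]. It splits into the series tail at [t] and the Abel
   integral of the tail, both of order 2^(-n). *)
have bound n : `|u t - (1 - c * abel a u t)| <= (K + `|c| * (K * b)) * 2^-1 ^+ n.
  have St : S n.+1 t = 1 - c * abel a (S n) t.
    by rewrite /S [in LHS](ger0_norm t0) abel_partial_sum.
  have -> : u t - (1 - c * abel a u t) =
      (u t - S n.+1 t) + c * (abel a u t + -1 * abel a (S n) t).
    by rewrite St; ring.
  rewrite -abelDZ//; last exact: continuous_partial_sum.
  apply: (le_trans (ler_normD _ _)); rewrite mulrDl lerD//.
    apply: (le_trans (uS _ _ tt)); rewrite ler_wpM2l// exprS ler_piMl//.
    by rewrite invf_le1// ler1n.
  rewrite normrM -mulrA ler_wpM2l//.
  rewrite mulrAC; apply: abel_le => //.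
    move=> s; apply: cvgD; first exact: cu.
    by apply: cvgM; [exact: cvg_cst|exact: continuous_partial_sum].
  by move=> s sT; rewrite mulN1r; exact: uS.
set D := u t - _ in bound; set C := K + _ in bound.
suff : D = 0 by move=> /eqP; rewrite subr_eq0 => /eqP ->; rewrite /c; ring.
apply/eqP; rewrite -normr_eq0 eq_le normr_ge0 andbT.
have cv : C * 2^-1 ^+ n @[n --> \oo] --> (0 : R).
  by apply: cvg_geometric; rewrite ger0_norm ?invr_ge0//; lra.
rewrite -(cvg_lim _ cv)//; apply: limr_ge; first by apply/cvg_ex; exists 0.
by near=> n; exact: bound.
Unshelve. all: by end_near.
Qed.

End mittag_leffler.

(** * The lower bound *)

Section lower_bound.
Context {R : realType}.
Notation mu := (@lebesgue_measure R).
Implicit Types a s t r x y M T : R.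

Lemma powR_normr1 a : `|1 : R| `^ a = 1.
Proof. by rewrite normr1 powR1. Qed.

Lemma continuousZ_fun (p : R) (f : R -> R) : continuous f -> continuous (fun s => p * f s).
Proof. by move=> cf s; apply: cvgM; [exact: cvg_cst|exact: cf]. Qed.

Lemma continuousDZ_fun (p : R) (f g : R -> R) : continuous f -> continuous g ->
  continuous (fun s => f s + p * g s).
Proof. by move=> cf cg s; apply: cvgD; [exact: cf|exact: continuousZ_fun]. Qed.

(** The minimum principle applies to u(s) = E_a(- x s^a), with [y0 = 1] and [phi = - x u], which is
    nonnegative wherever [u] is negative. The claim is its conclusion at s = 1. *)
Lemma mittag_leffler_ge0 a x : 0 < a < 1 -> 0 <= x -> 0 <= mittag_leffler a (- x).
Proof.
move=> a01 x0; have /andP[a0 a1] := a01.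
pose u s : R := mittag_leffler a (- (x * `|s| `^ a)).
have cu : continuous u by exact: continuous_mlsol.
rewrite -[x]mulr1 -(powR_normr1 a) -/(u 1).
have := @abel_comparison _ a 1 1 u (fun s => - (x * u s)) a01 cu.
apply; rewrite ?ler01 ?lexx//.
- by move=> s; apply: cvgN; exact: continuousZ_fun.
- move=> t /andP[t0 _]; rewrite {1}/u (ger0_norm t0); exact: abel_mittag_leffler.
- by move=> t _ ut0; rewrite oppr_ge0 mulr_ge0_le0// ltW.
Qed.

(** With u(s) = E_a(- M s^a), the difference w = z - z0 u has initial value 0 and is driven by g +
    z0 M u >= - M w, which is nonnegative wherever w < 0. The minimum principle gives w >= 0. *)
Lemma mittag_leffler_comparison a M T z0 (z g : R -> R) :
  0 < a < 1 -> 0 <= M -> 0 <= z0 -> continuous z -> continuous g ->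
  (forall t, 0 <= t <= T -> z t = z0 + (Gamma a)^-1 * abel a g t) ->
  (forall t, 0 <= t <= T -> 0 <= z t /\ - (M * z t) <= g t) ->
  forall t, 0 <= t <= T -> z0 * mittag_leffler a (- (M * t `^ a)) <= z t.
Proof.
move=> a01 M0 z00 cz cg zE zg t tT; have /andP[a0 a1] := a01.
pose u s : R := mittag_leffler a (- (M * `|s| `^ a)).
have cu : continuous u by exact: continuous_mlsol.
have /andP[t0 _] := tT.
rewrite -{1}(ger0_norm t0) -/(u t) -subr_ge0.
have cMu : continuous (fun s => - (M * u s)).
  by move=> s; apply: cvgN; exact: continuousZ_fun.
have := @abel_comparison _ a T 0 (fun s => z s + - z0 * u s)
  (fun s => g s + - z0 * - (M * u s)) a01.
rewrite -mulNr; apply; rewrite ?lexx//.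
- exact: continuousDZ_fun.
- exact: continuousDZ_fun.
- move=> s sT; have /andP[s0 _] := sT.
  rewrite abelDZ// zE// {1}/u (ger0_norm s0) abel_mittag_leffler//.
  by rewrite -/u; ring.
- move=> s sT ws0; have [zs gs] := zg _ sT.
  have : M * (z s + - z0 * u s) <= 0 by rewrite mulr_ge0_le0// ltW.
  by rewrite mulrDr; lra.
Qed.

(** The function u(s) = E_a(- x1 s^a) is nonnegative, hence - x1 u >= - x2 u, and it can play the
    role of [z] in the comparison with M = x2 at time 1. *)
Lemma mittag_leffler_nonincreasing a x1 x2 : 0 < a < 1 -> 0 <= x1 -> x1 <= x2 ->
  mittag_leffler a (- x2) <= mittag_leffler a (- x1).
Proof.
move=> a01 x10 x12; have /andP[a0 a1] := a01.
pose u s : R := mittag_leffler a (- (x1 * `|s| `^ a)).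
have cu : continuous u by exact: continuous_mlsol.
have := @mittag_leffler_comparison a x2 1 1 u (fun s => - (x1 * u s)) a01.
rewrite (le_trans x10 x12) ler01 => /(_ isT isT cu).
move=> /(_ _ _ _ 1); rewrite powR1 mul1r mulr1 ler01 lexx /u powR_normr1 mulr1.
apply=> //.
- by move=> s; apply: cvgN; exact: (continuousZ_fun x1 u cu).
- by move=> t /andP[t0 _]; rewrite {1}(ger0_norm t0); exact: abel_mittag_leffler.
- move=> t _; have us : 0 <= u t by apply: mittag_leffler_ge0 => //; rewrite mulr_ge0 ?powR_ge0.
  by split=> //; rewrite lerN2 ler_wpM2r.
Qed.

Lemma caputo_lower_bound a M T z0 (z g : R -> R) :
  0 < a < 1 -> 0 <= M -> 0 <= T -> 0 < z0 -> continuous z -> continuous g ->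
  (forall t, 0 <= t <= T -> z t = z0 + (Gamma a)^-1 * abel a g t) ->
  (forall t, 0 <= t <= T -> `|g t| <= M * `|z t|) ->
  z0 * mittag_leffler a (- (M * T `^ a)) <= `|z T|.
Proof.
move=> a01 M0 T0 z00 cz cg zE gM; have /andP[a0 a1] := a01.
(* The bound on [|g|] yields [g >= - M z] only where [z] is nonnegative, so the comparison is
   restricted to an interval on which [z] keeps its sign. *)
have pos T' : T' <= T -> (forall s, 0 <= s <= T' -> 0 <= z s) ->
    forall t, 0 <= t <= T' -> z0 * mittag_leffler a (- (M * t `^ a)) <= z t.
  move=> T'T zpos t tT'.
  have sub s : 0 <= s <= T' -> 0 <= s <= T.
    by move=> /andP[-> sT']; rewrite (le_trans sT').
  apply: (@mittag_leffler_comparison a M T' z0 z g) => //; first exact: ltW.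
  - by move=> s /sub; exact: zE.
  - move=> s sT'; have zs := zpos _ sT'; split => //.
    by have := gM _ (sub _ sT'); rewrite (ger0_norm zs) ler_norml => /andP[].
have [allpos|] := pselect (forall s, 0 <= s <= T -> 0 <= z s).
  apply: le_trans (ler_norm _); apply: (pos T) => //.
  by rewrite T0 lexx.
move=> /existsNP[s1 /not_implyP[s1T /negP]]; rewrite -ltNge => zs1.
pose S := [set s | 0 <= s <= T /\ z s <= 0].
have S0 : S !=set0 by exists s1; split => //; exact: ltW.
have lS : lbound S 0 by move=> s [/andP[]].
have hS : has_inf S by split => //; exists 0.
pose t1 := inf S.
have t1_ge0 : 0 <= t1 by exact: lb_le_inf.
have t1S s : S s -> t1 <= s by move=> Ss; apply: ge_inf => //; exists 0.
have t1T : t1 <= T.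
  have /andP[_ s1T'] := s1T; apply: le_trans s1T'; apply: t1S; split => //; exact: ltW.
have before s : 0 <= s -> s < t1 -> 0 < z s.
  move=> s0 st1'; rewrite ltNge; apply/negP => zs.
  move: (st1'); rewrite ltNge => /negP; apply; apply: t1S; split => //.
  by rewrite s0 (le_trans (ltW st1') t1T).
(* By continuity, a positive value would keep [S] away from its infimum, and a negative one would
   put a point of [S] strictly before it. *)
have t1z : z t1 = 0.
  apply/eqP; rewrite eq_le !leNgt; apply/andP; split; apply/negP => zt1.
    have /nbhs_ballP[e /= e0 he] : \forall s \near t1, 0 < z s.
      exact: (@cvgr_gt _ _ _ _ z (z t1) (cz t1) 0 zt1).
    have [s Ss st1] : exists2 s, S s & s < t1 + e by exact: inf_adherent.
    have ts := t1S _ Ss; have [_] := Ss.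
    rewrite leNgt he//= /ball/= distrC ger0_norm ?subr_ge0// ltrBlDl//.
  have /nbhs_ballP[e /= e0 he] : \forall s \near t1, z s < 0.
    exact: (@cvgr_lt _ _ _ _ z (z t1) (cz t1) 0 zt1).
  have t10 : 0 < t1.
    rewrite lt_neqAle t1_ge0 andbT; apply/eqP => t10.
    by move: zt1; rewrite -t10 zE ?lexx// abel0 mulr0 addr0 ltNge ltW.
  (* The maximum with 0 keeps [s] in the domain, while [s] stays within [e] of [t1], where [z] is
     negative, against [before]. *)
  pose s := Num.max 0 (t1 - e / 2).
  have st1 : s < t1 by rewrite gt_max t10/=; lra.
  have s0 : 0 <= s by rewrite le_max lexx.
  have := before _ s0 st1; rewrite ltNge ltW// he//= /ball/=.
  have : t1 - e / 2 <= s by rewrite le_max lexx orbT.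
  by rewrite ger0_norm ?subr_ge0 ?(ltW st1)//; lra.
have : z0 * mittag_leffler a (- (M * t1 `^ a)) <= 0.
  rewrite -t1z; apply: (pos t1) => //; last by rewrite t1_ge0 lexx.
  move=> s /andP[s0]; rewrite le_eqVlt => /predU1P[->|]; first by rewrite t1z.
  by move=> /(before _ s0) /ltW.
rewrite pmulr_rle0// => Et1; apply: (@le_trans _ _ 0) => //.
rewrite pmulr_rle0//; apply: le_trans Et1; apply: mittag_leffler_nonincreasing => //.
  by rewrite mulr_ge0// powR_ge0.
by rewrite ler_wpM2l//; apply: ge0_ler_powR; rewrite ?nnegrE ?(ltW a0).
Qed.

Lemma continuous_within_comp (U V : topologicalType) (A : set U) (h : U -> V) (c : R -> U) :
  {within A, continuous h} -> continuous c -> (forall s, A (c s)) ->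
  continuous (h \o c).
Proof.
move=> /subspace_continuousP ch cc Ac s.
apply: cvg_comp (ch _ (Ac s)) => P /= nP.
have cP : \forall x \near s, A (c x) -> P (c x) := cc s _ nP.
by apply: filterS cP => x Px; exact: (Px (Ac x)).
Qed.

(** By linearity, x2 - x1 is driven by f(s, x2) - f(s, x1), whose size is at most L(s) |x2 - x1|,
    hence at most the supremum of [L] times |x2 - x1|. This is the situation of
    [caputo_lower_bound]. *)
Lemma caputo_solution_lower_bound a (J : set R) (f : R -> R -> R) (L x1 x2 : R -> R) t :
  0 < a < 1 -> `[0, t] `<=` J -> 0 <= t ->
  {within [set p : R * R | J p.1], continuous (fun p => f p.1 p.2)} ->
  {within J, continuous L} ->
  (forall s, J s -> 0 <= L s) ->
  (forall s, J s -> forall u v : R, `|f s u - f s v| <= L s * `|u - v|) ->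
  caputo_solution a J f x1 ->
  caputo_solution a J f x2 ->
  x1 0 < x2 0 ->
  `|x2 0 - x1 0| * mittag_leffler a (- (sup (L @` `[0, t]) * t `^ a))
    <= `|x2 t - x1 t|.
Proof.
move=> a01 sJ t0 cf cL L0 lip [cx1 x1E] [cx2 x2E] x120; have /andP[a0 a1] := a01.
(* Composing with the projection onto [0, t] makes all functions continuous on R. *)
pose c s := Num.min (Num.max 0 s) t.
have c0t s : 0 <= c s <= t by rewrite /c le_min le_max lexx t0/= ge_min lexx orbT.
have cJ s : J (c s) by apply: sJ; rewrite /= in_itv/=; exact: c0t.
have cE s : 0 <= s <= t -> c s = s.
  by move=> /andP[s0 st]; rewrite /c (max_idPr s0) (min_idPl st).
have cc : continuous c.
  move=> s; apply: continuous_min; last exact: cst_continuous.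
  by apply: continuous_max => //; exact: cst_continuous.
have cX (x : R -> R) : {within J, continuous x} -> continuous (x \o c).
  by move=> cx; exact: (continuous_within_comp _ _ J).
have cF (x : R -> R) : {within J, continuous x} -> continuous (fun s => f (c s) (x (c s))).
  move=> cx; apply: (continuous_within_comp _ _ _ (fun p => f p.1 p.2)
    (fun s => (c s, x (c s))) cf); last by move=> s; exact: cJ.
  move=> s; exact: (@cvg_pair _ _ _ _ (nbhs (c s)) (nbhs (x (c s))) _ _ _
    c (x \o c) (cc s) (cX _ cx s)).
pose M := sup (L @` `[0, t]).
have ubL : has_ubound (L @` `[0, t]).
  have [B _ LB] := continuous_itv_bounded _ _ t0 (cX _ cL).
  exists B => _ [s /= st <-]; rewrite in_itv/= in st.
  by have := LB _ st; rewrite /= cE//; apply: le_trans; exact: ler_norm.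
have LM s : 0 <= s <= t -> L s <= M.
  by move=> st; apply: ub_le_sup => //; exists s => //=; rewrite in_itv.
have tt : 0 <= t <= t by rewrite t0 lexx.
have oo : (0 : R) <= 0 <= t by apply/andP; split.
have M0 : 0 <= M by apply: le_trans (LM _ oo); apply: L0; rewrite -(cE 0).
(* On [0, tau] the projection [c] is the identity, so the Volterra integral is unchanged. *)
have abelF (x : R -> R) tau : 0 <= tau <= t -> Rintegral mu `[0, tau]
    (fun s => (tau - s) `^ (a - 1) * f s (x s)) = abel a (fun s => f (c s) (x (c s))) tau.
  move=> /andP[tau0 taut]; apply: eq_Rintegral => s; rewrite inE/= in_itv/= => /andP[s0 st].
  by rewrite cE// s0 (le_trans st).
have := @caputo_lower_bound a M t (x2 0 - x1 0) (fun s => x2 (c s) + - 1 * x1 (c s))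
  (fun s => f (c s) (x2 (c s)) + -1 * f (c s) (x1 (c s))) a01 M0 t0.
rewrite subr_gt0 x120 (cE t)// mulN1r.
rewrite (@gtr0_norm _ (x2 0 - x1 0)) ?subr_gt0//; apply => //.
- by apply: continuousDZ_fun; exact: cX.
- by apply: continuousDZ_fun; exact: cF.
- move=> s st; have Js : J s by rewrite -(cE s).
  have /andP[s0 _] := st.
  rewrite cE// abelDZ//; [|exact: cF|exact: cF].
  by rewrite -!abelF// x2E// x1E//; ring.
- move=> s st; rewrite !cE// !mulN1r.
  have Js : J s by rewrite -(cE s).
  by apply: (le_trans (lip _ Js _ _)); rewrite ler_wpM2r// LM.
Qed.

End lower_bound.

Theorem mainTheorem2 (R : realType) (a : R) (J : set R)
    (f : R -> R -> R) (L : R -> R) (x1 x2 : R -> R) :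
  0 < a < 1 ->
  ((exists T : R, 0 < T /\ J = [set` `[0, T]]) \/ J = [set` `[0, +oo[]) ->
  {within [set p : R * R | J p.1], continuous (fun p => f p.1 p.2)} ->
  {within J, continuous L} ->
  (forall t, J t -> 0 <= L t) ->
  (forall t, J t -> forall u v : R, `|f t u - f t v| <= L t * `|u - v|) ->
  caputo_solution a J f x1 ->
  caputo_solution a J f x2 ->
  forall t, J t ->
    `|x2 0 - x1 0| * mittag_leffler a (- (sup (L @` `[0, t]) * t `^ a))
      <= `|x2 t - x1 t|.
Proof.
move=> a01 JE cf cL L0 lip s1 s2 t Jt.
have [sJ t0] : `[0, t] `<=` J /\ 0 <= t.
  case: JE Jt => [[T [_ ->]]|->] /=; rewrite in_itv/=.
    move=> /andP[t0 tT]; split => // s /=; rewrite !in_itv/= => /andP[-> st].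
    exact: le_trans tT.
  by rewrite andbT => t0; split => // s /=; rewrite !in_itv/= => /andP[->].
(* Equal initial values make the left-hand side zero; the two strict cases are exchanged by swapping
   the solutions. *)
have [x12|x21|->] := ltgtP (x1 0) (x2 0); last by rewrite subrr normr0 mul0r.
  exact: (caputo_solution_lower_bound a J f).
rewrite distrC [leRHS]distrC.
exact: (caputo_solution_lower_bound a J f).
Qed.
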